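(* Let $n=2k+1\ge 3$ be odd and let $a_1,\dots,a_n$ be positive real numbers. With indices read modulo $n$, define for $j=1,\dots,n$ $$t_j=\tfrac12\sum_{m=0}^{n-1}(-1)^m a_{j+m}=\tfrac12\left(a_j-a_{j+1}+a_{j+2}-\cdots+a_{j+n-1}\right).$$ Then there exists a convex $n$-gon circumscribed about a circle whose side lengths, in cyclic order, are $a_1,\dots,a_n$ if and only if $t_j>0$ for every $j=1,\dots,n$. Moreover, in that case, let $s=(a_1+\cdots+a_n)/2$ and let $\sigma_m$ denote the $m$-th elementary symmetric function of $t_1,\dots,t_n$. Then the polynomial $$\sigma_1x^k-\sigma_3x^{k-1}+\sigma_5x^{k-2}-\cdots+(-1)^k\sigma_n$$ has exactly $k$ roots, all of them distinct positive real numbers. Every convex $n$-gon circumscribed about a circle with side lengths $a_1,\dots,a_n$ in cyclic order has inscribed circle of radius $r_1$, where $r_1>0$ and $r_1^2$ is the largest root of this polynomial, and its area is $K=s\,r_1$.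
   Context: A convex $n$-gon is circumscribed about a circle if it encloses the circle and each of its $n$ sides is tangent to the circle. ''Side lengths $a_1,\dots,a_n$ in cyclic order'' means that the vertices can be labelled consecutively $P_1,\dots,P_n$ (indices modulo $n$) so that $|P_jP_{j+1}|=a_j$ for all $j$. *)

(* Defs.v *)
From HB Require Import structures.
From mathcomp Require Import all_boot all_order all_algebra.
From mathcomp Require Import complex.
From mathcomp Require Import all_classical all_reals all_analysis.

Set Implicit Arguments.
Unset Strict Implicit.
Unset Printing Implicit Defensive.

Import Order.TTheory GRing.Theory Num.Theory.

Local Open Scope classical_set_scope.
Local Open Scope ring_scope.

(* The plane is R * R.  Euclidean distance is spelled out because the norm that
   the library puts on R * R is the sup norm. *)

Definition edist (R : realType) (x y : R * R) : R :=
  Num.sqrt ((x.1 - y.1) ^+ 2 + (x.2 - y.2) ^+ 2).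

Definition circle (R : realType) (c : R * R) (r : R) : set (R * R) :=
  [set x | edist x c = r].

Definition affine_pt (R : realType) (A B : R * R) (t : R) : R * R :=
  ((1 - t) * A.1 + t * B.1, (1 - t) * A.2 + t * B.2).

Definition line (R : realType) (A B : R * R) : set (R * R) :=
  [set x | exists t : R, x = affine_pt A B t].

Definition segment (R : realType) (A B : R * R) : set (R * R) :=
  [set x | exists t : R, 0 <= t <= 1 /\ x = affine_pt A B t].

(* Positive iff A, B, C is a counterclockwise triangle, 0 iff collinear. *)
Definition orient (R : realType) (A B C : R * R) : R :=
  (B.1 - A.1) * (C.2 - A.2) - (B.2 - A.2) * (C.1 - A.1).

(* A polygon with n.+1 vertices is a family P : 'I_n.+1 -> R * R, listed in
   cyclic order; inZp : nat -> 'I_n.+1 is reduction modulo n.+1, so the vertex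
   following P j is P (inZp j.+1). *)

(* For every side, all the other vertices lie strictly on one and the same side
   of the line carrying it.  Both orientations are allowed.  Strictness
   makes the vertices distinct and excludes straight angles; self-crossing
   polygons are excluded as well. *)
Definition convex_polygon (R : realType) (n : nat) (P : 'I_n.+1 -> R * R) : Prop :=
  forall j : 'I_n.+1,
    (forall i : 'I_n.+1, i != j -> i != inZp j.+1 ->
       0 < orient (P j) (P (inZp j.+1)) (P i)) \/
    (forall i : 'I_n.+1, i != j -> i != inZp j.+1 ->
       orient (P j) (P (inZp j.+1)) (P i) < 0).

(* The region bounded by a convex polygon: the convex hull of its vertices. *)
Definition polygon_region (R : realType) (n : nat) (P : 'I_n.+1 -> R * R) :
    set (R * R) :=
  [set x | exists w : 'I_n.+1 -> R,
     [/\ forall i, 0 <= w i, \sum_i w i = 1 &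
         x = (\sum_i w i * (P i).1, \sum_i w i * (P i).2)]].

Definition area (R : realType) (n : nat) (P : 'I_n.+1 -> R * R) : \bar R :=
  ((@lebesgue_measure R) \x (@lebesgue_measure R))%E (polygon_region P).

(* The line AB meets the circle in a single point, which belongs to the closed
   segment AB. *)
Definition side_tangent (R : realType) (A B c : R * R) (r : R) : Prop :=
  exists T : R * R, segment A B T /\ line A B `&` circle c r = [set T].

Definition circumscribed (R : realType) (n : nat) (P : 'I_n.+1 -> R * R)
    (c : R * R) (r : R) : Prop :=
  [/\ 0 < r, circle c r `<=` polygon_region P &
      forall j : 'I_n.+1, side_tangent (P j) (P (inZp j.+1)) c r].

Definition has_side_lengths (R : realType) (n : nat) (P : 'I_n.+1 -> R * R)
    (a : 'I_n.+1 -> R) : Prop :=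
  forall j : 'I_n.+1, edist (P j) (P (inZp j.+1)) = a j.

Definition tlen (R : realType) (n : nat) (a : 'I_n.+1 -> R) (j : 'I_n.+1) : R :=
  2^-1 * \sum_(m < n.+1) (-1) ^+ m * a (inZp (j + m)%N).

Definition elem_sym (R : realType) (n : nat) (t : 'I_n.+1 -> R) (m : nat) : R :=
  \sum_(A : {set 'I_n.+1} | #|A| == m) \prod_(i in A) t i.

Definition radius_poly (R : realType) (k : nat) (t : 'I_(2 * k).+1 -> R) : {poly R} :=
  \sum_(i < k.+1) ((-1) ^+ i * elem_sym t (2 * i)%N.+1) *: 'X^(k - i)%N.

(* Main.v *)
Require Import Defs.
From HB Require Import structures.
From mathcomp Require Import all_boot all_order all_algebra.
From mathcomp Require Import complex.
From mathcomp Require Import all_classical all_reals all_analysis.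
From mathcomp Require Import measurable_realfun zify ring lra.

Set Implicit Arguments.
Unset Strict Implicit.
Unset Printing Implicit Defensive.

Import Order.TTheory GRing.Theory Num.Theory.
Import numFieldNormedType.Exports.

Local Open Scope classical_set_scope.
Local Open Scope ring_scope.

(** Let [P_1 .. P_n] be circumscribed about a circle of radius [r].  The two tangent
segments issued from [P_j] have a common length [t_j], and [a_j = t_j + t_(j+1)];
since [n] is odd this system has the unique solution [t_j = tlen a j].  Strict
convexity makes every [t_j] positive and forces the points of tangency to turn
exactly once around the centre, so that [sum_j atan (t_j / r) = pi]; conversely any
[r] satisfying this equation yields a polygon, by placing the points of tangency at
the successive angles [2 atan (t_j / r)].  The left-hand side decreases from [n pi / 2]
to [0] as [r] grows, so it takes each of the values [pi, 2 pi, .., k pi] once.  On the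
other hand [p(r^2) = Im prod_j (r + i t_j)], which is a positive multiple of
[sin (sum_j atan (t_j / r))]: these [k] values of [r^2] are the roots of [p], and [pi]
corresponds to the largest.  The area is the sum of the areas [r a_j / 2] of the
triangles joining the centre to the sides. *)

(** * The radius polynomial as an imaginary part *)

Lemma big_ord_double (V : nmodType) (F : nat -> V) n :
  \sum_(m < 2 * n) F m = \sum_(i < n) (F (2 * i)%N + F (2 * i).+1).
Proof.
elim: n => [|n IH]; first by rewrite muln0 !big_ord0.
by rewrite mulnS !big_ord_recr /= IH addrA.
Qed.

Section RadiusPolynomial.
Context {R : realType}.
Implicit Types (x y r : R).

Lemma Im_sum (I : Type) (s : seq I) (P : pred I) (F : I -> R[i]) :
  complex.Im (\sum_(i <- s | P i) F i) = \sum_(i <- s | P i) complex.Im (F i).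
Proof. by apply: (big_morph (@complex.Im R)) => // -[? ?] [? ?]. Qed.

Lemma Im_expi_even m x : complex.Im ((0 +i* 1)%C ^+ (2 * m) * real_complex R x) = 0.
Proof.
have -> : (0 +i* 1)%C ^+ (2 * m) = real_complex R ((-1) ^+ m).
  by rewrite exprM sqr_i rmorphXn rmorphN rmorph1.
by rewrite -rmorphM.
Qed.

Lemma Im_expi_odd m x :
  complex.Im ((0 +i* 1)%C ^+ (2 * m).+1 * real_complex R x) = (-1) ^+ m * x.
Proof.
have -> : (0 +i* 1)%C ^+ (2 * m).+1 = (0 +i* 1)%C * real_complex R ((-1) ^+ m).
  by rewrite exprS exprM sqr_i rmorphXn rmorphN rmorph1.
by rewrite -mulrA -rmorphM /= mul0r mul1r add0r.
Qed.

(** Expanding the product picks [i t_j] on a subset of the indices and [x] on its complement;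
    subsets of equal cardinality [m] share the factor [i^m x^(n+1-m)]. *)
Lemma prod_addi_expand n (t : 'I_n.+1 -> R) x :
  \prod_j (x +i* t j)%C =
  \sum_(m < n.+2) (0 +i* 1)%C ^+ m * real_complex R (elem_sym t m * x ^+ (n.+1 - m)).
Proof.
pose F j : R[i] := (0 +i* 1)%C * real_complex R (t j).
have FE j : (x +i* t j)%C = F j + real_complex R x.
  by rewrite /F addrC {1}[LHS]complexE.
under eq_bigr do rewrite FE.
rewrite bigA_distr.
(* The cardinality is at most [n.+1], so [inord] into ['I_n.+2] loses nothing. *)
rewrite (partition_big (fun A : {set 'I_n.+1} => inord #|A| : 'I_n.+2) xpredT)//=.
apply: eq_bigr => m _; rewrite /elem_sym mulr_suml rmorph_sum mulr_sumr.
have cardE (A : {set 'I_n.+1}) : (inord #|A| == m :> 'I_n.+2) = (#|A| == m).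
  by rewrite -val_eqE /= inordK// ltnS (leq_trans (max_card _))// card_ord.
apply: eq_big => [A|A]; first by rewrite cardE.
rewrite cardE => /eqP cA.
rewrite (bigID (fun i => i \in A)) /=.
rewrite (eq_bigr F); last by move=> i ->.
rewrite [X in _ * X](eq_bigr (fun=> real_complex R x)); last first.
  by move=> i /negbTE ->.
rewrite big_split /= prodr_const cA -rmorph_prod prodr_const.
rewrite -rmorphXn -mulrA -rmorphM; congr (_ * real_complex R (_ * _ ^+ _)).
have := cardC A; rewrite card_ord cA => /(congr1 (subn^~ m)); rewrite addKn => <-.
by apply: eq_card => i; rewrite inE.
Qed.

(** Even powers of [i] are real and drop out; [i^(2m+1)] contributes the sign [(-1)^m], and the
    remaining exponent [2k - 2m] of [x] is even, hence a power of [x^2]. *)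
Lemma horner_radius_poly k (t : 'I_(2 * k).+1 -> R) x :
  (radius_poly t).[x ^+ 2] = complex.Im (\prod_j (x +i* t j)%C).
Proof.
rewrite prod_addi_expand Im_sum (_ : (2 * k).+2 = 2 * k.+1)%N; last by rewrite mulnS.
rewrite (big_ord_double (fun m => complex.Im (_ ^+ m * real_complex R (elem_sym t m * x ^+ (_ - m))))).
rewrite horner_sum; apply: eq_bigr => i _.
rewrite Im_expi_even Im_expi_odd add0r hornerZ hornerXn -exprM -mulrA.
by rewrite subSS -mulnBr.
Qed.

Lemma size_radius_poly k (t : 'I_(2 * k).+1 -> R) :
  (forall j, 0 < t j) -> size (radius_poly t) = k.+1.
Proof.
move=> t0.
(* The term of index 0 is isolated: it alone has degree [k], and its coefficient is the sum of the
   positive [t j]. *)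
rewrite /radius_poly -(big_mkord xpredT
  (fun i => ((-1) ^+ i * elem_sym t (2 * i).+1) *: 'X^(k - i))) big_nat_recl//=.
rewrite subn0 expr0 mul1r muln0.
have s0 : elem_sym t 1 != 0.
  rewrite gt_eqF//; apply: (@lt_le_trans _ _ (\prod_(i in [set ord0]%SET) t i)).
    by rewrite big_set1.
  rewrite /elem_sym (bigD1 [set ord0]%SET) /= ?cards1// lerDl sumr_ge0// => A _.
  by rewrite prodr_ge0// => i _; exact: ltW.
have sX : size (elem_sym t 1 *: 'X^k) = k.+1 by rewrite size_scale// size_polyXn.
rewrite size_polyDl sX// ltnS (leq_trans (size_sum _ _ _))//.
apply/bigmax_leqP_seq => i; rewrite mem_index_iota => /andP[_ ik] _.
rewrite (leq_trans (size_scale_leq _ _))// size_polyXn.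
by lia.
Qed.

End RadiusPolynomial.

(** * Roots of the radius polynomial *)

Section RadiusRoots.
Context {R : realType}.
Implicit Types (x y r : R).

(** The variable [y] is the reciprocal of the radius, which makes the sum increasing and continuous
    on the whole line, with value 0 at 0. *)
Definition half_angle_sum n (t : 'I_n -> R) y := \sum_j atan (t j * y).

Lemma cos_atan_gt0 x : 0 < cos (atan x).
Proof. by rewrite cos_atan invr_gt0 sqrtr_gt0 ltr_pwDl// sqr_ge0. Qed.

Lemma mul_sin_atan x : sin (atan x) = x * cos (atan x).
Proof. by rewrite -{2}[x]atanK /tan divfK// gt_eqF ?cos_atan_gt0. Qed.

(** The factor [y^-1 + i t_j] has argument [atan (t_j y)] and modulus [1 / (y cos (atan (t_j y)))];
    moduli multiply and arguments add. *)
Lemma prod_addi_polar n (t : 'I_n -> R) y : 0 < y ->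
  complex.Im (\prod_j (y^-1 +i* t j)%C) =
  (\prod_j (y * cos (atan (t j * y)))^-1) * sin (half_angle_sum t y).
Proof.
move=> y0; rewrite /half_angle_sum.
(* The induction on the list of factors needs the real part as well. *)
suff -> : \prod_j (y^-1 +i* t j)%C =
   let p := \prod_j (y * cos (atan (t j * y)))^-1 in
   (p * cos (\sum_j atan (t j * y)) +i* (p * sin (\sum_j atan (t j * y))))%C by [].
elim: (index_enum _) => [|j s IH] /=.
  by rewrite !big_nil cos0 sin0 mulr1 mulr0.
rewrite !big_cons IH sinD cosD mul_sin_atan /=.
have c0 : cos (atan (t j * y)) != 0 by rewrite gt_eqF ?cos_atan_gt0.
have yn : y != 0 by rewrite gt_eqF.
by congr (_ +i* _)%C; field; rewrite c0 yn.
Qed.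

Lemma root_radius_poly k (t : 'I_(2 * k).+1 -> R) y : 0 < y ->
  root (radius_poly t) (y^-1 ^+ 2) = (sin (half_angle_sum t y) == 0).
Proof.
move=> y0; rewrite rootE horner_radius_poly prod_addi_polar// mulf_eq0.
rewrite (negbTE (_ : _ != 0))//; apply/prodf_neq0 => j _.
by rewrite invr_eq0 gt_eqF// mulr_gt0// cos_atan_gt0.
Qed.

Lemma half_angle_sum_lt n (t : 'I_n.+1 -> R) : (forall j, 0 < t j) ->
  {homo half_angle_sum t : x y / x < y}.
Proof.
move=> t0 x y xy; have lt_j j : atan (t j * x) < atan (t j * y).
  by apply: lt_atan; rewrite ltr_pM2l.
rewrite /half_angle_sum !big_ord_recl ltr_leD// ler_sum// => j _.
exact: ltW.
Qed.

Lemma half_angle_sum0 n (t : 'I_n -> R) : half_angle_sum t 0 = 0.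
Proof. by apply: big1 => j _; rewrite mulr0 atan0. Qed.

Lemma continuous_half_angle_sum n (t : 'I_n -> R) : continuous (half_angle_sum t).
Proof.
move=> y; apply: (@continuous_big _ _ _ _ _ _ _ _ (fun j z => atan (t j * z))) => [|j _ z].
  exact: add_continuous.
apply: continuous_comp; last exact: continuous_atan.
exact: mulrl_continuous.
Qed.

Lemma half_angle_sum_surj k (t : 'I_(2 * k).+1 -> R) m : (forall j, 0 < t j) ->
  (0 < m <= k)%N -> exists2 y, 0 < y & half_angle_sum t y = m%:R * pi.
Proof.
move=> t0 /andP[m0 mk].
have pi0 : 0 < pi :> R by exact: pi_gt0.
(* If every angle is at least [g < pi / 2], the sum is at least [k pi]. The bound [Y] dominates each
   [tan g / t j], so this happens at [Y], and the intermediate value theorem applies on [[0, Y]]. *)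
pose g : R := k%:R * pi / (2 * k).+1%:R.
have n0 : 0 < (2 * k).+1%:R :> R by rewrite ltr0n.
have g0 : 0 <= g by rewrite !mulr_ge0// ?invr_ge0 ltW.
have g2 : g < pi / 2.
  rewrite /g ltr_pdivrMr// -[(2 * k).+1]addn1 natrD natrM; nra.
pose Y := \sum_j tan g / t j.
have tg0 : 0 <= tan g.
  rewrite divr_ge0// ?sin_ge0_pi ?g0//=; first by lra.
  by apply/ltW/cos_gt0_pihalf; lra.
have Yj j : tan g / t j <= Y.
  rewrite /Y (bigD1 j)//= lerDl sumr_ge0// => i _.
  by rewrite divr_ge0// ltW.
have Y0 : 0 <= Y by rewrite sumr_ge0// => i _; rewrite divr_ge0// ltW.
have FY : k%:R * pi <= half_angle_sum t Y.
  have -> : k%:R * pi = \sum_(j < (2 * k).+1) g.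
    by rewrite sumr_const card_ord -[RHS]mulr_natr /g divfK// gt_eqF.
  apply: ler_sum => j _.
  rewrite -[g]tanK ?in_itv/= ?g2 ?andbT; last by lra.
  by apply: le_atan; rewrite mulrC -ler_pdivrMr.
have mpi : 0 < m%:R * pi :> R by rewrite mulr_gt0// ltr0n.
have mkpi : m%:R * pi <= k%:R * pi :> R by rewrite ler_pM2r// ler_nat.
have cF := continuous_subspaceT (A := `[0, Y]) (@continuous_half_angle_sum _ t).
have [|z] := IVT (v := m%:R * pi) Y0 cF.
  by rewrite half_angle_sum0 ge_min le_max ltW//= (le_trans mkpi FY) orbT.
rewrite in_itv/= => /andP[z0 _] Fz; exists z => //.
rewrite lt_def z0 andbT; apply/eqP => zE.
by move: Fz; rewrite zE half_angle_sum0 => /eqP; rewrite eq_sym gt_eqF.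
Qed.

(** The angle sums [pi, .., k pi] give [k] distinct positive roots [y^-2]. The degree is [k], so the
    polynomial splits over the complex numbers with exactly these roots. *)
Lemma radius_poly_complex_roots k (t : 'I_(2 * k).+1 -> R) :
  (forall j, 0 < t j) ->
  exists rs : seq R,
    [/\ size rs = k, uniq rs, (forall x, x \in rs -> 0 < x) &
      forall z : R[i], root (map_poly (real_complex R) (radius_poly t)) z <->
                       exists2 x, x \in rs & z = real_complex R x].
Proof.
move=> t0.
have /choice[y yP] (m : nat) : exists y, (0 < m <= k)%N ->
    0 < y /\ half_angle_sum t y = m%:R * pi.
  have [mk|] := boolP (0 < m <= k)%N; last by exists 0.
  by have [y] := half_angle_sum_surj t0 mk; exists y.
have inI m : (m \in iota 1 k) = (0 < m <= k)%N by rewrite mem_iota add1n ltnS.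
pose rs := [seq (y m)^-1 ^+ 2 | m <- iota 1 k].
have rs0 x : x \in rs -> 0 < x.
  by move=> /mapP[m]; rewrite inI => /yP[y0 _] ->; rewrite exprn_gt0// invr_gt0.
have urs : uniq rs.
  rewrite map_inj_in_uniq ?iota_uniq// => m m'; rewrite !inI => /yP[y0 Fy] /yP[y0' Fy'].
  move=> /eqP; rewrite eqrXn2// ?invr_ge0 ?ltW// => /eqP /invr_inj yy.
  move: Fy; rewrite yy Fy' => /(mulIf (lt0r_neq0 (pi_gt0 R))) /eqP.
  by rewrite eqr_nat => /eqP.
exists rs; split => //; first by rewrite size_map size_iota.
pose q := map_poly (real_complex R) (radius_poly t).
have sq : size q = (size [seq real_complex R x | x <- rs]).+1.
  by rewrite size_map_poly size_radius_poly// !size_map size_iota.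
have qE : q = lead_coef q *: \prod_(z <- [seq real_complex R x | x <- rs]) ('X - z%:P).
  apply: all_roots_prod_XsubC => //.
    rewrite all_map; apply/allP => x /mapP[m]; rewrite inI => /yP[y0 Fy] -> /=.
    rewrite fmorph_root root_radius_poly// Fy mulrC mulr_natr.
    by rewrite -[pi *+ m]add0r (alternatingn (@sinDpi R)) sin0 mulr0.
  by rewrite uniq_rootsE map_inj_uniq//; exact: complexI.
move=> z; rewrite -/q qE rootZ ?root_prod_XsubC; last first.
  by rewrite lead_coef_eq0 -size_poly_eq0 sq.
split=> [/mapP[x xrs ->]|[x xrs ->]]; first by exists x.
by rewrite map_f.
Qed.

Lemma sin_half_angle_sum_neq0 n (t : 'I_n.+1 -> R) y1 y : (forall j, 0 < t j) ->
  half_angle_sum t y1 = pi -> 0 < y < y1 -> sin (half_angle_sum t y) != 0.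
Proof.
move=> t0 F1 /andP[y0 yy1]; rewrite gt_eqF// sin_gt0_pi// -F1.
by rewrite -{1}(half_angle_sum0 t) !half_angle_sum_lt.
Qed.

(** A number beyond [y1^-2] is [y^-2] for some [0 < y < y1]; there the angle sum lies strictly
    between 0 and [pi], and its sine does not vanish. *)
Lemma root_radius_poly_le k (t : 'I_(2 * k).+1 -> R) y1 x :
  (forall j, 0 < t j) -> 0 < y1 -> half_angle_sum t y1 = pi ->
  root (radius_poly t) x -> x <= y1^-1 ^+ 2.
Proof.
move=> t0 y10 F1; apply: contraLR; rewrite -ltNge => x1.
have x0 : 0 < x by rewrite (lt_trans _ x1)// exprn_gt0// invr_gt0.
have s0 : 0 < (Num.sqrt x)^-1 by rewrite invr_gt0 sqrtr_gt0.
have -> : x = ((Num.sqrt x)^-1)^-1 ^+ 2 by rewrite invrK sqr_sqrtr// ltW.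
rewrite root_radius_poly//; apply: (sin_half_angle_sum_neq0 t0 F1).
rewrite s0 -[y1]invrK ltf_pV2 ?posrE ?sqrtr_gt0 ?invr_gt0//.
by rewrite -(@ltr_pXn2r _ 2) ?nnegrE ?sqrtr_ge0 ?invr_ge0 ?(ltW y10)// sqr_sqrtr// ltW.
Qed.

End RadiusRoots.

(** * Tangent lengths *)

Section CyclicIndices.
Variable n : nat.
Implicit Types (i j : 'I_n.+1).

(** A folded form of the successor index, convertible with the one used in the definitions of
    polygons. *)
Definition cnext j : 'I_n.+1 := inZp j.+1.
Arguments cnext : simpl never.

Lemma val_cnext j : cnext j = (if j == n :> nat then 0 else j.+1)%N :> nat.
Proof.
rewrite /cnext /=; case: eqP => [->|jn]; first by rewrite modnn.
by rewrite modn_small//; have := ltn_ord j; lia.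
Qed.

Lemma cnext_inZp m : cnext (inZp m) = inZp m.+1.
Proof. by apply: val_inj; rewrite /cnext /= -addn1 modnDml addn1. Qed.

Lemma cnext_inj : injective cnext.
Proof.
move=> i j /(congr1 (@nat_of_ord _)); rewrite !val_cnext => ij.
by apply: val_inj => /=; move: ij (ltn_ord i) (ltn_ord j); do 2 case: eqP => ?; lia.
Qed.

Lemma cnext_surj j : exists i, j = cnext i.
Proof. by exists (invF cnext_inj j); rewrite f_invF. Qed.

Lemma cyclic_ind (P : 'I_n.+1 -> Prop) :
  P ord0 -> (forall j, P j -> P (cnext j)) -> forall j, P j.
Proof.
move=> P0 PS j; rewrite -[j]valZpK; elim: (val j) => [|m IH].
  by rewrite (_ : inZp 0 = ord0)//; apply: val_inj; rewrite /= mod0n.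
by rewrite -cnext_inZp; exact: PS.
Qed.

Lemma cnext_neq j : (0 < n)%N -> cnext j != j.
Proof.
move=> n0; apply/eqP => /(congr1 (@nat_of_ord _)).
by rewrite val_cnext; case: eqP; lia.
Qed.

Lemma cnext2_neq j : (1 < n)%N -> cnext (cnext j) != j.
Proof.
move=> n1; apply/eqP => /(congr1 (@nat_of_ord _)).
by rewrite 2!val_cnext; have := ltn_ord j; do 2 case: eqP; lia.
Qed.

End CyclicIndices.

(** * Points of a tangent line, in the frame of its unit normal *)

Section Tangential.
Context {R : realType}.
Implicit Types (A B c u x : R * R) (r p q e : R).

(** For a unit vector [u], the tangent to the circle at [c + r u] is the line where this signed
    distance equals [r]. *)
Definition height c u x := (x.1 - c.1) * u.1 + (x.2 - c.2) * u.2.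

(* [c + r u + q J u], where [J] is the rotation by a right angle *)
Definition frame_pt c r u q : R * R :=
  (c.1 + r * u.1 - q * u.2, c.2 + r * u.2 + q * u.1).

Definition unitv u := u.1 ^+ 2 + u.2 ^+ 2 = 1.

Lemma height_frame_pt c r u q : unitv u -> height c u (frame_pt c r u q) = r.
Proof. by rewrite /unitv /height /= => uu; rewrite -[RHS]mulr1 -uu; ring. Qed.

Lemma sqr_dist_frame_pt c r u q : unitv u ->
  ((frame_pt c r u q).1 - c.1) ^+ 2 + ((frame_pt c r u q).2 - c.2) ^+ 2 =
  r ^+ 2 + q ^+ 2.
Proof. by move=> uu; rewrite -[RHS]mulr1 -uu /=; ring. Qed.

Lemma edist_sqr A B : Defs.edist A B ^+ 2 = (A.1 - B.1) ^+ 2 + (A.2 - B.2) ^+ 2.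
Proof. by rewrite sqr_sqrtr// addr_ge0// sqr_ge0. Qed.

Lemma circleP c r x : 0 < r ->
  circle c r x <-> (x.1 - c.1) ^+ 2 + (x.2 - c.2) ^+ 2 = r ^+ 2.
Proof.
move=> r0; rewrite /circle /=; split=> [<-|xr].
  by rewrite edist_sqr; ring.
by rewrite /Defs.edist [X in Num.sqrt X](_ : _ = r ^+ 2) ?sqrtr_sqr ?gtr0_norm// -xr; ring.
Qed.

(** A single common point must be the foot of the perpendicular from [c], so [u] is the direction
    from [c] to [T]. The signed lengths [p] and [q] of the two pieces of the side have the same sign
    because [T] belongs to the segment. *)
Lemma side_tangent_frame A B c r : 0 < r -> 0 < Defs.edist A B ->
  side_tangent A B c r ->
  exists u p q, [/\ unitv u, A = frame_pt c r u (- p), B = frame_pt c r u q,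
    0 <= p * q & (p + q) ^+ 2 = Defs.edist A B ^+ 2].
Proof.
move=> r0 AB0 [T [[s [/andP[s0 s1] TE]] LC]].
have [LT /(circleP c T r0) CT] : (line A B `&` circle c r) T by rewrite LC.
pose d1 := B.1 - A.1; pose d2 := B.2 - A.2.
have dd : d1 ^+ 2 + d2 ^+ 2 = Defs.edist A B ^+ 2 by rewrite edist_sqr /d1 /d2; ring.
have dd0 : 0 < d1 ^+ 2 + d2 ^+ 2 by rewrite dd exprn_gt0.
pose w1 := T.1 - c.1; pose w2 := T.2 - c.2.
pose k := 2 * (d1 * w1 + d2 * w2) / (d1 ^+ 2 + d2 ^+ 2).
have kE : k * (d1 ^+ 2 + d2 ^+ 2) = 2 * (d1 * w1 + d2 * w2).
  by rewrite divfK// gt_eqF.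
(* the reflection of [T] in the foot of the perpendicular from [c] *)
have T'T : affine_pt A B (s - k) = T.
  have : [set T] (affine_pt A B (s - k)); last by [].
  rewrite -LC; split; first by exists (s - k).
  apply/(circleP c _ r0).
  have -> : (affine_pt A B (s - k)).1 - c.1 = w1 - k * d1.
    by rewrite /w1 TE /= /d1; ring.
  have -> : (affine_pt A B (s - k)).2 - c.2 = w2 - k * d2.
    by rewrite /w2 TE /= /d2; ring.
  rewrite -CT -/w1 -/w2.
  have -> : (w1 - k * d1) ^+ 2 + (w2 - k * d2) ^+ 2 = w1 ^+ 2 + w2 ^+ 2 +
    k * (k * (d1 ^+ 2 + d2 ^+ 2) - 2 * (d1 * w1 + d2 * w2)) by ring.
  by rewrite kE subrr mulr0 addr0.
have [kd1 kd2] : k * d1 = 0 /\ k * d2 = 0.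
  have /(congr1 fst) := T'T; have /(congr1 snd) := T'T; rewrite TE /= => e2 e1.
  by rewrite /d1 /d2; split; lra.
have dw : d1 * w1 + d2 * w2 = 0.
  have : k * (d1 ^+ 2 + d2 ^+ 2) = 0.
    by rewrite mulrDr !expr2 !mulrA kd1 kd2 !mul0r addr0.
  by rewrite kE; lra.
pose u := (w1 / r, w2 / r).
have rn : r != 0 by rewrite gt_eqF.
have uu : unitv u.
  by rewrite /unitv /= !expr_div_n -mulrDl CT divff// expf_neq0.
(* [h] is the signed length of the side along the rotated normal; the component along [u] vanishes
   by [dw]. *)
pose h := d2 * u.1 - d1 * u.2.
have wr : w1 ^+ 2 + w2 ^+ 2 = r ^+ 2 by [].
have d1E : d1 = - h * u.2.
  rewrite -[LHS]mulr1 -uu /h /=.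
  have -> : d1 * ((w1 / r) ^+ 2 + (w2 / r) ^+ 2) =
     (w1 / r) * (d1 * w1 + d2 * w2) / r - (d2 * (w1 / r) - d1 * (w2 / r)) * (w2 / r).
    by field.
  by rewrite dw; ring.
have d2E : d2 = h * u.1.
  rewrite -[LHS]mulr1 -uu /h /=.
  have -> : d2 * ((w1 / r) ^+ 2 + (w2 / r) ^+ 2) =
     (w2 / r) * (d1 * w1 + d2 * w2) / r + (d2 * (w1 / r) - d1 * (w2 / r)) * (w1 / r).
    by field.
  by rewrite dw; ring.
have T1 : T.1 = c.1 + r * u.1 by rewrite /u /= mulrC divfK// /w1; ring.
have T2 : T.2 = c.2 + r * u.2 by rewrite /u /= mulrC divfK// /w2; ring.
have TE1 : T.1 = A.1 + s * d1 by rewrite TE /= /d1; ring.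
have TE2 : T.2 = A.2 + s * d2 by rewrite TE /= /d2; ring.
exists u, (s * h), ((1 - s) * h); split => //.
- rewrite [A]surjective_pairing /frame_pt -T1 -T2 TE1 TE2 d1E d2E.
  by congr pair; ring.
- have -> : B = (A.1 + d1, A.2 + d2).
    by rewrite [LHS]surjective_pairing /d1 /d2; congr pair; ring.
  rewrite /frame_pt -T1 -T2 TE1 TE2 d1E d2E.
  by congr pair; ring.
- have -> : s * h * ((1 - s) * h) = s * (1 - s) * h ^+ 2 by ring.
  by rewrite mulr_ge0 ?sqr_ge0// mulr_ge0//; lra.
- have -> : s * h + (1 - s) * h = h by ring.
  by rewrite -dd d1E d2E -[LHS]mulr1 -uu; ring.
Qed.

(* [u j] is the outer unit normal of side [j], [t j] the common length of the two
   tangents from [P j], and [e] the orientation of the polygon. *)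
Record tangential n (P : 'I_n.+1 -> R * R) c r e (u : 'I_n.+1 -> R * R)
    (t : 'I_n.+1 -> R) : Prop := Tangential {
  tan_r0 : 0 < r;
  tan_e : e = 1 \/ e = -1;
  tan_u : forall j, unitv (u j);
  tan_t0 : forall j, 0 < t j;
  tan_P : forall j, P j = frame_pt c r (u j) (- (e * t j));
  tan_PS : forall j, P (cnext j) = frame_pt c r (u j) (e * t (cnext j));
  tan_lt : forall j i, i != j -> i != cnext j -> height c (u j) (P i) < r }.

(** Twice a signed triangle area, as base times height: the base lies on the tangent line, from
    which [x] has signed distance [r - height c u x]. *)
Lemma orient_frame c r u p q x : unitv u ->
  orient (frame_pt c r u (- p)) (frame_pt c r u q) x = (p + q) * (r - height c u x).
Proof.
move=> uu; rewrite (_ : r - _ = r * (u.1 ^+ 2 + u.2 ^+ 2) - height c u x); last first.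
  by rewrite uu mulr1.
by rewrite /orient /height /=; ring.
Qed.

Lemma orient_rot A B x : orient A B x = orient B x A.
Proof. by rewrite /orient; ring. Qed.

End Tangential.

(** * Tangent lengths of a circumscribed polygon *)

Section PolygonTangential.
Context {R : realType}.
Implicit Types (c x : R * R) (r e : R).

Lemma hull_height n (P : 'I_n.+1 -> R * R) c u x w :
  \sum_i w i = 1 -> x = (\sum_i w i * (P i).1, \sum_i w i * (P i).2) ->
  height c u x = \sum_i w i * height c u (P i).
Proof.
move=> w1 ->; rewrite /height /=.
rewrite -[X in (_ - X) * _ + _]mul1r -[X in _ + (_ - X) * _]mul1r -w1 !mulr_suml.
rewrite -!sumrB !mulr_suml -big_split /=.
by apply: eq_bigr => i _; ring.
Qed.

Lemma circumscribed_tangential n (P : 'I_n.+1 -> R * R) c r (a : 'I_n.+1 -> R) :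
  (1 < n)%N -> (forall j, 0 < a j) ->
  convex_polygon P -> circumscribed P c r -> has_side_lengths P a ->
  exists e u t, tangential P c r e u t /\ forall j, a j = t j + t (cnext j).
Proof.
move=> n1 a0 cvx [r0 circ tgt] sl.
have n0 : (0 < n)%N by exact: ltnW.
have frame j : exists upq : (R * R) * R * R, [/\ unitv upq.1.1,
    P j = frame_pt c r upq.1.1 (- upq.1.2),
    P (cnext j) = frame_pt c r upq.1.1 upq.2,
    0 <= upq.1.2 * upq.2 & (upq.1.2 + upq.2) ^+ 2 = a j ^+ 2].
  have [|u [p [q [uu PA PB pq h]]]] := side_tangent_frame r0 _ (tgt j).
    by rewrite sl.
  by exists (u, p, q); rewrite -(sl j).
have [f fP] := choice frame.
pose u j := (f j).1.1; pose p j := (f j).1.2; pose q j := (f j).2.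
have uu j : unitv (u j) by case: (fP j).
have PA j : P j = frame_pt c r (u j) (- p j) by case: (fP j).
have PB j : P (cnext j) = frame_pt c r (u j) (q j) by case: (fP j).
have pq j : 0 <= p j * q j by case: (fP j).
have h2 j : (p j + q j) ^+ 2 = a j ^+ 2 by case: (fP j).
have orE j x : orient (P j) (P (cnext j)) x = (p j + q j) * (r - height c (u j) x).
  by rewrite {1}PA PB orient_frame.
have hA j : height c (u j) (P j) = r by rewrite PA height_frame_pt.
have hB j : height c (u j) (P (cnext j)) = r by rewrite PB height_frame_pt.
have lt_r j i : i != j -> i != cnext j -> height c (u j) (P i) < r.
  (* the point of the circle opposite to the side is an average of vertices *)
  have /circ[w [w0 w1 wE]] : circle c r (frame_pt c (- r) (u j) 0).
    by apply/(circleP c _ r0); rewrite sqr_dist_frame_pt// expr0n/= addr0 sqrrN.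
  have hw := hull_height c (u j) w1 wE; rewrite height_frame_pt// in hw.
  (* The average height is [-r], so some vertex is strictly below the tangent line; by convexity all
     vertices off the side are then on that same side of it. *)
  have [i0 i0P] : exists i, 0 < r - height c (u j) (P i).
    apply: contrapT => /forallNP H.
    have : r <= \sum_i w i * height c (u j) (P i); last by rewrite -hw; lra.
    rewrite -[r in r <= _]mul1r -w1 mulr_suml; apply: ler_sum => i' _.
    by rewrite ler_wpM2l// leNgt -subr_gt0; apply/negP; exact: H.
  have i0A : i0 != j by apply/eqP => i0E; move: i0P; rewrite i0E hA subrr ltxx.
  have i0B : i0 != cnext j by apply/eqP => i0E; move: i0P; rewrite i0E hB subrr ltxx.
  move=> ij ij'; rewrite -subr_gt0.
  case: (cvx j) => sgn; have := sgn _ i0A i0B; have := sgn _ ij ij'; rewrite !orE.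
    by move=> H1; rewrite pmulr_lgt0// => h0; move: H1; rewrite pmulr_rgt0.
  by move=> H1; rewrite pmulr_llt0// => h0; move: H1; rewrite nmulr_rlt0.
(* Consecutive signed sides have the same sign: the orientation of the triangle of three successive
   vertices can be computed from either side, each time with a positive height. *)
have hS j : 0 < (p j + q j) * (p (cnext j) + q (cnext j)).
  have A : 0 < r - height c (u j) (P (cnext (cnext j))).
    by rewrite subr_gt0 lt_r ?cnext2_neq// cnext_neq.
  have B : 0 < r - height c (u (cnext j)) (P j).
    by rewrite subr_gt0 lt_r// eq_sym ?cnext_neq// cnext2_neq.
  have : (p j + q j) ^+ 2 != 0 by rewrite h2 expf_neq0// gt_eqF.
  rewrite expf_eq0/= => hn.
  have := orE j (P (cnext (cnext j))); rewrite orient_rot orE => E.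
  have H : 0 < (p j + q j) ^+ 2 by rewrite lt_def expf_neq0// sqr_ge0.
  rewrite -(pmulr_rgt0 _ B) mulrCA [_ * (p _ + _)]mulrC E mulrA -expr2.
  by rewrite mulr_gt0.
(* The sign of one side propagates to all sides by [hS] and cyclic induction. *)
pose e : R := Num.sg (p ord0 + q ord0).
have e0 : e = 1 \/ e = -1.
  have h0 : p ord0 + q ord0 != 0.
    by apply: contraTneq (hS ord0) => ->; rewrite mul0r ltxx.
  by move: h0; rewrite /e -sgr_eq0; case: sgrP => [_|_|_]; rewrite ?eqxx; auto.
have ee : e * e = 1 by case: e0 => ->; rewrite ?mulr1// mulrNN mulr1.
have eh j : 0 < e * (p j + q j).
  elim/cyclic_ind: j => [|j IH].
    rewrite /e -normrEsg normr_gt0.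
    by apply: contraTneq (hS ord0) => ->; rewrite mul0r ltxx.
  by rewrite -(pmulr_rgt0 _ IH) mulrACA ee mul1r.
have ep j : 0 <= e * p j by have := eh j; have := pq j; case: e0 => ->; nra.
have eq' j : 0 <= e * q j by have := eh j; have := pq j; case: e0 => ->; nra.
(* By Pythagoras both tangents from a vertex have the same square, determined by its distance to
   [c]; the common sign [e] excludes opposite values. *)
have eqp j : q j = e * (e * p (cnext j)).
  rewrite mulrA ee mul1r.
  have : q j ^+ 2 = p (cnext j) ^+ 2.
    apply: (@addrI _ (r ^+ 2)); rewrite -(sqr_dist_frame_pt c r (q j) (uu j)) -PB.
    by rewrite PA sqr_dist_frame_pt// sqrrN.
  move=> /eqP; rewrite eqf_sqr => /orP[/eqP //|/eqP E].
  have := eq' j; have := ep (cnext j); rewrite E.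
  by case: e0 => ->; lra.
have aE j : a j = e * p j + e * p (cnext j).
  have : e * (p j + q j) = a j.
    apply/eqP; rewrite -(@eqrXn2 _ 2) ?(ltW (eh j)) ?(ltW (a0 j))//.
    by rewrite exprMn h2 [e ^+ 2]expr2 ee mul1r.
  by move=> <-; rewrite mulrDr eqp mulrA ee mul1r.
exists e, u, (fun j => e * p j); split => //; split => //.
(* If the tangent length at a vertex vanished, this vertex would be the point of tangency of both
   its sides. Their normals would agree, and the next vertex would lie on the previous side's line,
   against [lt_r]. *)
- move=> j; have [i ->] := cnext_surj j.
  rewrite lt_def ep andbT; apply/eqP => p0.
  have q0 : q i = 0 by rewrite eqp p0 mulr0.
  have p0' : p (cnext i) = 0.
    by rewrite -[LHS]mul1r -ee -mulrA p0 mulr0.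
  have u_eq : u i = u (cnext i).
    have := PB i; rewrite PA p0' q0 oppr0 /frame_pt => -[E1 E2].
    have rn : r != 0 by rewrite gt_eqF.
    rewrite [LHS]surjective_pairing [RHS]surjective_pairing.
    by congr pair; apply: (mulfI rn); lra.
  have := lt_r i (cnext (cnext i)).
  by rewrite cnext_neq// cnext2_neq// u_eq hB ltxx => /(_ isT isT).
- by move=> j; rewrite mulrA ee mul1r.
- by move=> j; rewrite -eqp.
Qed.

Lemma sum_alternating (f : nat -> R) n :
  \sum_(m < n) (-1) ^+ m * (f m + f m.+1) = f 0%N - (-1) ^+ n * f n.
Proof.
elim: n => [|n IH]; first by rewrite big_ord0 mul1r subrr.
by rewrite big_ord_recr /= IH exprS; ring.
Qed.

Lemma sgn_odd k : (-1) ^+ (2 * k).+1 = -1 :> R.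
Proof. by rewrite exprS exprM sqrrN expr1n expr1n mulr1. Qed.

Lemma inZpDn n (j : 'I_n.+1) : inZp (j + n.+1) = j.
Proof. by apply: val_inj; rewrite /= modnDr modn_small. Qed.

(** The alternating sum telescopes to its two ends, which are both [t j] after a full cycle; since
    the number of sides is odd they add up instead of cancelling. *)
Lemma tlen_tangent_lengths k (a t : 'I_(2 * k).+1 -> R) :
  (forall j, a j = t j + t (cnext j)) -> tlen a =1 t.
Proof.
move=> at_ j; rewrite /tlen.
under eq_bigr do rewrite at_ cnext_inZp -addnS.
rewrite (sum_alternating (fun m => t (inZp (j + m)))) sgn_odd inZpDn.
rewrite addn0 valZpK; lra.
Qed.

Lemma tlen_add_cnext k (a : 'I_(2 * k).+1 -> R) j :
  tlen a j + tlen a (cnext j) = a j.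
Proof.
rewrite /tlen -mulrDr -big_split /=.
under eq_bigr => m _.
  rewrite -mulrDr (_ : inZp (cnext j + m) = inZp (j + m.+1)).
    over.
  by apply: val_inj; rewrite /cnext /= modnDml addSnnS.
rewrite (sum_alternating (fun m => a (inZp (j + m)))) sgn_odd inZpDn.
rewrite addn0 valZpK; lra.
Qed.

End PolygonTangential.

(** * The total turn around the circle *)

Section AngleSum.
Context {R : realType}.
Implicit Types (c x v w : R * R) (r e al t : R).

(* rotation of [v] by the angle [e * th], for [e = 1] or [e = -1] *)
Definition rotv e th v : R * R :=
  (cos th * v.1 - e * sin th * v.2, cos th * v.2 + e * sin th * v.1).

Lemma rotv0 e v : rotv e 0 v = v.
Proof.
by rewrite /rotv cos0 sin0 mulr0 !mul0r !mul1r subr0 addr0 -surjective_pairing.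
Qed.

Lemma rotvD e th th' v : e * e = 1 -> rotv e (th + th') v = rotv e th' (rotv e th v).
Proof.
move=> ee; rewrite /rotv /= cosD sinD; congr pair; ring: ee.
Qed.

Lemma unitv_rotv e th v : e * e = 1 -> unitv v -> unitv (rotv e th v).
Proof.
move=> ee; rewrite /unitv /= => vv; have := cos2Dsin2 th => cs.
rewrite [LHS](_ : _ = (cos th ^+ 2 + e * e * sin th ^+ 2) * (v.1 ^+ 2 + v.2 ^+ 2)).
  by rewrite ee mul1r cs vv mul1r.
by ring.
Qed.

Lemma cos_atan_div t r : 0 < r ->
  t * cos (atan (t * r^-1)) = r * sin (atan (t * r^-1)).
Proof. by move=> r0; rewrite mul_sin_atan; field; rewrite gt_eqF. Qed.

(** The ray from [c] to the common vertex makes the angle [atan (t / r)] with each of the two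
    normals. *)
Lemma frame_pt_rotv c r e t v w : e * e = 1 -> 0 < r ->
  frame_pt c r w (- (e * t)) = frame_pt c r v (e * t) ->
  w = rotv e (2 * atan (t * r^-1)) v.
Proof.
move=> ee r0; rewrite /frame_pt => -[E1 E2].
set al := atan _; have rn : r != 0 by rewrite gt_eqF.
have cs := cos2Dsin2 al; have tC := cos_atan_div t r0; rewrite -/al in tC.
(* [F1] and [F2] state that [w] turned back by [al] equals [v] turned forward by [al]: both point
   from [c] to the vertex. *)
have F1 : cos al * w.1 + e * sin al * w.2 = cos al * v.1 - e * sin al * v.2.
  have E : r * w.1 + e * t * w.2 = r * v.1 - e * t * v.2 by lra.
  apply: (mulfI rn).
  have -> : r * (cos al * w.1 + e * sin al * w.2) = cos al * (r * w.1 + e * t * w.2).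
    by ring: tC.
  by rewrite E; ring: tC.
have F2 : cos al * w.2 - e * sin al * w.1 = cos al * v.2 + e * sin al * v.1.
  have E : r * w.2 - e * t * w.1 = r * v.2 + e * t * v.1 by lra.
  apply: (mulfI rn).
  have -> : r * (cos al * w.2 - e * sin al * w.1) = cos al * (r * w.2 - e * t * w.1).
    by ring: tC.
  by rewrite E; ring: tC.
rewrite [LHS]surjective_pairing /rotv mulr2n mulrDl !mul1r cosD sinD.
have wE z : z = (cos al ^+ 2 + e * e * sin al ^+ 2) * z by rewrite ee mul1r cs mul1r.
congr pair; rewrite [LHS]wE.
  rewrite (_ : _ * w.1 = cos al * (cos al * w.1 + e * sin al * w.2) -
    e * sin al * (cos al * w.2 - e * sin al * w.1)); last by ring.
  by rewrite F1 F2; ring: ee.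
rewrite (_ : _ * w.2 = cos al * (cos al * w.2 - e * sin al * w.1) +
  e * sin al * (cos al * w.1 + e * sin al * w.2)); last by ring.
by rewrite F1 F2; ring: ee.
Qed.

Lemma frame_pt_rotvE c r e t v : e * e = 1 -> 0 < r ->
  frame_pt c r (rotv e (2 * atan (t * r^-1)) v) (- (e * t)) =
  frame_pt c r v (e * t).
Proof.
move=> ee r0; have rn : r != 0 by rewrite gt_eqF.
rewrite /frame_pt /rotv; set al := atan _.
have tC := cos_atan_div t r0; rewrite -/al in tC.
have cs := sin2cos2 al.
rewrite mulr2n mulrDl !mul1r cosD sinD /=.
by congr pair; ring: tC ee cs.
Qed.

(** The vertex is at distance [r / cos al] from [c], where [al = atan (t / r)], in the direction at
    angle [th - al] from [v]. *)
Lemma height_rotv c r e t th v : e * e = 1 -> 0 < r -> unitv v ->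
  height c v (frame_pt c r (rotv e th v) (- (e * t))) *
    cos (atan (t * r^-1)) = r * cos (th - atan (t * r^-1)).
Proof.
move=> ee r0 vv; rewrite cosB; set al := atan _.
have tC := cos_atan_div t r0; rewrite -/al in tC.
rewrite mulrDr [r * (sin _ * _)]mulrCA -tC -[RHS]mulr1 -vv /height /=.
ring: ee.
Qed.

Lemma height_rotv_lt c r e t th v : e * e = 1 -> 0 < r -> unitv v ->
  (height c v (frame_pt c r (rotv e th v) (- (e * t))) < r) =
  (cos (th - atan (t * r^-1)) < cos (atan (t * r^-1))).
Proof.
move=> ee r0 vv; have c0 := cos_atan_gt0 (t * r^-1).
by rewrite -(ltr_pM2r c0) height_rotv// ltr_pM2l.
Qed.

(* [turn t r m] is the sum of the half-angles at vertices [1 .. m] *)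
Definition turn n (t : 'I_n.+1 -> R) r m :=
  \sum_(i < m) atan (t (inZp i.+1) * r^-1).

Lemma turn0 n (t : 'I_n.+1 -> R) r : turn t r 0 = 0.
Proof. exact: big_ord0. Qed.

Lemma turnS n (t : 'I_n.+1 -> R) r m :
  turn t r m.+1 = turn t r m + atan (t (inZp m.+1) * r^-1).
Proof. exact: big_ord_recr. Qed.

Lemma turn_full n (t : 'I_n.+1 -> R) r : turn t r n.+1 = half_angle_sum t r^-1.
Proof.
rewrite turnS addrC /half_angle_sum big_ord_recl; congr (atan (t _ * _) + _).
  by apply: val_inj; rewrite /= modnn.
apply: eq_bigr => i _; congr (atan (t _ * _)).
by apply: val_inj; rewrite /= /bump leq0n add1n modn_small// ltnS.
Qed.

Lemma half_angle_gt0 t r : 0 < t -> 0 < r -> 0 < atan (t * r^-1).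
Proof. by move=> t0 r0; rewrite -atan0 lt_atan// mulr_gt0// invr_gt0. Qed.

Lemma turn_lt n (t : 'I_n.+1 -> R) r m m' : (forall j, 0 < t j) -> 0 < r ->
  (m < m')%N -> turn t r m < turn t r m'.
Proof.
move=> t0 r0; apply: (homo_ltn (r := fun x y : R => x < y)) => [x y z /lt_trans|i].
  exact.
by rewrite turnS ltrDl half_angle_gt0.
Qed.

(** The index [m] ranges over all natural numbers: [m = n.+1] returns to [u ord0] and yields the
    closing condition. *)
Lemma tangential_turn n (P u : 'I_n.+1 -> R * R) c r e
    (t : 'I_n.+1 -> R) m : tangential P c r e u t ->
  u (inZp m) = rotv e (2 * turn t r m) (u ord0).
Proof.
move=> [r0 e1 uu t0 PA PB _]; have ee : e * e = 1 by case: e1 => ->; rewrite ?mulrNN mulr1.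
elim: m => [|m IH].
  rewrite turn0 mulr0 rotv0; congr u; apply: val_inj; rewrite /= mod0n//.
rewrite turnS mulrDr rotvD// -IH -cnext_inZp; apply: (@frame_pt_rotv c) => //.
by rewrite -PA PB.
Qed.

(** Closing up forces the sum to be a positive multiple of [pi]. With at least two full turns, some
    vertex off side 0 would be reached as the first turn is completed, and it could not lie strictly
    below the line of side 0. *)
Lemma tangential_half_angle_sum n (P u : 'I_n.+1 -> R * R) c r e
    (t : 'I_n.+1 -> R) :
  tangential P c r e u t -> half_angle_sum t r^-1 = pi.
Proof.
move=> T; have [r0 e1 uu t0 PA PB Plt] := T.
have ee : e * e = 1 by case: e1 => ->; rewrite ?mulrNN mulr1.
have pi0 := pi_gt0 R.
pose B := turn t r; pose al m := atan (t (inZp m) * r^-1).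
have BS m : B m.+1 = B m + al m.+1 by exact: turnS.
have al0 m : 0 < al m by exact: half_angle_gt0.
have al2 m : al m < pi / 2 by exact: atan_ltpi2.
rewrite -turn_full -/B; set S := B n.+1.
have S0 : 0 < S by rewrite -(turn0 t r) turn_lt.
have cosS : cos (2 * S) = 1.
  have := tangential_turn n.+1 T; rewrite (_ : inZp n.+1 = ord0); last first.
    by apply: val_inj; rewrite /= modnn.
  move=> /(congr1 (fun v => v.1 * (u ord0).1 + v.2 * (u ord0).2)).
  rewrite -!expr2 uu /rotv /= -/B -/S => E.
  by rewrite [RHS]E -[LHS]mulr1 -[X in _ * X](uu ord0) /=; ring.
have sinS : sin S = 0.
  apply/eqP; rewrite -sqrf_eq0 sin2cos2; apply/eqP.
  by move: cosS; rewrite mulr2n mulrDl !mul1r cosD -!expr2 sin2cos2; lra.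
have pS : pi <= S.
  rewrite leNgt; apply/negP => SP.
  by have := @sin_gt0_pi R S; rewrite S0 SP sinS ltxx => /(_ isT).
apply/eqP; rewrite eq_le pS andbT leNgt; apply/negP => Spi.
have S2 : 2 * pi <= S.
  rewrite leNgt; apply/negP => SP.
  have := @sin_gt0_pi R (S - pi).
  have := sinDpi (S - pi); rewrite subrK sinS => E.
  have -> : 0 < S - pi < pi by apply/andP; split; lra.
  by move=> /(_ isT); lra.
(* the first vertex whose tangent arc contains the full turn *)
have ex : exists i, pi < B i by exists n.+1.
case: (ex_minnP ex) => i iP imin.
have i1 : (i <= n.+1)%N by exact: imin.
case: i iP i1 imin => [|i]; first by rewrite /B turn0 ltNge ltW.
rewrite BS => iP i1 imin.
have Bi : B i <= pi by rewrite leNgt; apply/negP => /imin; rewrite ltnn.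
(* The vertex found is [i.+1]. Each half-angle is below [pi / 2], so it is not vertex 1; nor is it
   the last one, which would give a total below [3 pi / 2]. *)
have i0 : (0 < i)%N.
  by case: i iP Bi {i1 imin} => // + _; rewrite /B turn0; have := al2 1%N; lra.
have ine : i != n.
  by apply/eqP => iE; move: S2; rewrite /S BS -iE; have := al2 i.+1; lra.
have ilt : (i < n)%N by lia.
have vi : (inZp i.+1 : 'I_n.+1) = i.+1 :> nat by rewrite /= modn_small.
have h1 : inZp i.+1 != ord0 :> 'I_n.+1.
  by apply/eqP => /(congr1 (@nat_of_ord _)); rewrite vi.
have h2 : inZp i.+1 != cnext ord0 :> 'I_n.+1.
  by apply/eqP => /(congr1 (@nat_of_ord _)); rewrite vi val_cnext /=; case: eqP; lia.
have := Plt ord0 (inZp i.+1) h1 h2.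
rewrite PA (tangential_turn i.+1 T) height_rotv_lt// -/B BS -/(al i.+1).
(* From [B i <= pi < B i.+1], the direction of the vertex is within [al i.+1] of the first normal
   modulo [2 pi]. *)
have -> : 2 * (B i + al i.+1) - al i.+1 = (2 * B i + al i.+1 - pi *+ 2) + pi *+ 2 by ring.
rewrite (@cosD2pi R) -[cos (_ - _)]cos_norm.
rewrite ltr_cos ?in_itv/=.
- by rewrite ltNge real_ler_norml ?num_real// mulr2n; lra.
- by have := al0 i.+1; have := al2 i.+1; lra.
- rewrite normr_ge0 /= real_ler_norml ?num_real// mulr2n.
  by have := al2 i.+1; lra.
Qed.

End AngleSum.

(** * Construction of the polygon *)

Section Construction.
Context {R : realType}.
Implicit Types (c x v w : R * R) (r e al : R).

Lemma cos_lt_arc (al d : R) : 0 <= al -> al < d -> d < pi *+ 2 - al -> cos d < cos al.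
Proof.
rewrite mulr2n => al0 ald dal; have pi0 := pi_gt0 R.
have [dpi|dpi] := leP d pi.
  by rewrite ltr_cos// in_itv/=; lra.
rewrite -[cos d]cosN -(@cosD2pi R (- d)) mulr2n.
by rewrite ltr_cos ?in_itv/=; lra.
Qed.

(** The normals are placed at the angles [2 turn t r m]. A vertex off side [j] is below its line
    because its direction is farther than its own half-angle from the normal, modulo [2 pi]. *)
Lemma tangential_exists n (t : 'I_n.+1 -> R) r : (forall j, 0 < t j) -> 0 < r ->
  half_angle_sum t r^-1 = pi ->
  exists P u : 'I_n.+1 -> R * R, tangential P (0, 0) r 1 u t.
Proof.
move=> t0 r0 Spi; have pi0 := pi_gt0 R.
have e1 : 1 * 1 = 1 :> R by rewrite mulr1.
(* Indexing by natural numbers separates the recursion [US] from the closing condition [Un], which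
   is where the total [pi] is used. *)
pose U m := rotv 1 (2 * turn t r m) (1, 0).
have uU m : unitv (U m).
  by apply: unitv_rotv => //; rewrite /unitv /= expr1n expr0n/= addr0.
have US m : U m.+1 = rotv 1 (2 * atan (t (inZp m.+1) * r^-1)) (U m).
  by rewrite /U turnS mulrDr rotvD.
have Un : U n.+1 = U 0%N.
  rewrite /U turn_full Spi turn0 mulr0 rotv0 /rotv.
  by rewrite mulr_natl cos2pi sin2pi /= !mulr1 !mulr0 subr0 addr0.
pose P j := frame_pt (0, 0) r (U (nat_of_ord j)) (- (1 * t j)).
exists P, (fun j => U (nat_of_ord j)); split => //; first by left.
- move=> j; rewrite /P.
  have -> : U (nat_of_ord (cnext j)) = U j.+1.
    by rewrite val_cnext; case: eqP => // ->.
  by rewrite US frame_pt_rotvE.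
- move=> j i ij ij'.
  rewrite /P; pose th := 2 * (turn t r i - turn t r j).
  have -> : U (nat_of_ord i) = rotv 1 th (U j).
    by rewrite /U -rotvD// /th; congr rotv; ring.
  rewrite height_rotv_lt//.
  have al0 := half_angle_gt0 (t0 i) r0.
  set al := atan _ in al0 *.
  have turn_i m : i = m.+1 :> nat -> turn t r i = turn t r m + al.
    by move=> im; rewrite im turnS -im valZpK.
  have turn_pi m : (m <= n)%N -> turn t r m < pi.
    by move=> mn; rewrite -Spi -turn_full turn_lt.
  have turn_ge0 m : 0 <= turn t r m.
    by case: m => [|m]; rewrite ?turn0// -(turn0 t r) ltW// turn_lt.
  have ln := ltn_ord i; have ljn := ltn_ord j.
  have jpi := turn_pi j ljn; have ipi := turn_pi i ln.
  have [ltij|ltji] := ltnP i j.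
    have -> : th - al = (th - al + pi *+ 2) - pi *+ 2 by ring.
    have dij := turn_lt t0 r0 ltij.
    rewrite -(@cosD2pi R) subrK; apply: cos_lt_arc; rewrite ?(ltW al0)// mulr2n.
      (* Since [turn] starts at vertex 1, the half-angle of vertex 0 is the last summand of the
         total; for [i = 0] one uses [j < n], as side [n] ends at vertex 0. *)
      case: (posnP i) => [i0|/prednK/esym/turn_i E]; last first.
        by have := turn_ge0 i.-1; rewrite /th; lra.
      have jn : (j < n)%N.
        rewrite ltn_neqAle -ltnS ljn andbT; apply: contra ij' => jn.
        by apply/eqP/val_inj; rewrite /= [RHS]val_cnext jn.
      have := turn_lt t0 r0 jn; have := turn_full t r; rewrite turnS Spi.
      have -> : inZp n.+1 = i by apply: val_inj; rewrite /= modnn.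
      by rewrite -/al /th i0 turn0; lra.
    by rewrite /th; lra.
  have jlt : (j.+1 < i)%N.
    have ji : (j < i)%N by rewrite ltn_neqAle ltji andbT eq_sym.
    rewrite ltn_neqAle ji andbT; apply: contra ij' => /eqP ji'.
    by apply/eqP/val_inj; rewrite /= [RHS]val_cnext; case: eqP; lia.
  case E : (nat_of_ord i) jlt => [//|m] jm; have := turn_i _ E => Ei.
  have := @turn_lt R n t r j m t0 r0 jm => dj.
  apply: cos_lt_arc; rewrite ?(ltW al0)// /th ?mulr2n.
    by lra.
  by have := turn_ge0 j; lra.
Qed.

Lemma tangential_convex n (P u : 'I_n.+1 -> R * R) c r e (t : 'I_n.+1 -> R) :
  tangential P c r e u t -> convex_polygon P.
Proof.
move=> [r0 e1 uu t0 PA PB Plt] j.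
have orE i : orient (P j) (P (cnext j)) (P i) =
    e * ((t j + t (cnext j)) * (r - height c (u j) (P i))).
  by rewrite {1}PA PB orient_frame// -mulrDr mulrA.
have tt : 0 < t j + t (cnext j) by rewrite addr_gt0.
case: e1 orE => -> orE; [left|right] => i ij ij'; rewrite orE.
  by rewrite mul1r mulr_gt0// subr_gt0 Plt.
by rewrite mulN1r oppr_lt0 mulr_gt0// subr_gt0 Plt.
Qed.

Lemma tangential_side_lengths n (P u : 'I_n.+1 -> R * R) c r e (t : 'I_n.+1 -> R) :
  tangential P c r e u t -> has_side_lengths P (fun j => t j + t (cnext j)).
Proof.
move=> [r0 e1 uu t0 PA PB Plt] j.
have tt : 0 <= t j + t (cnext j) by rewrite addr_ge0// ltW.
apply/eqP; rewrite -(@eqrXn2 _ 2) ?sqrtr_ge0// edist_sqr PA PB /=.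
have ee : e ^+ 2 = 1 by case: e1 => ->; rewrite ?sqrrN expr1n.
apply/eqP; rewrite -[RHS]mulr1 -(uu j) -[RHS]mul1r -ee; ring.
Qed.

Lemma tangential_side_tangent n (P u : 'I_n.+1 -> R * R) c r e (t : 'I_n.+1 -> R) j :
  tangential P c r e u t -> side_tangent (P j) (P (cnext j)) c r.
Proof.
move=> [r0 e1 uu t0 PA PB Plt]; have ee : e ^+ 2 = 1.
  by case: e1 => ->; rewrite ?sqrrN expr1n.
have tt : 0 < t j + t (cnext j) by rewrite addr_gt0.
have afE s : affine_pt (P j) (P (cnext j)) s =
    frame_pt c r (u j) (e * (s * (t j + t (cnext j)) - t j)).
  by rewrite PA PB /affine_pt /frame_pt /=; congr pair; ring.
pose s0 := t j / (t j + t (cnext j)).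
have s0E : s0 * (t j + t (cnext j)) - t j = 0 by rewrite divfK ?subrr// gt_eqF.
exists (frame_pt c r (u j) 0); split.
  exists s0; split; last by rewrite afE s0E mulr0.
  by rewrite divr_ge0 ?(ltW (t0 j)) ?(ltW tt)//= ler_pdivrMr// mul1r lerDl ltW.
apply/seteqP; split=> [x [[s ->]]|x ->].
  move=> /(circleP c _ r0); rewrite afE sqr_dist_frame_pt// exprMn ee mul1r => E.
  have /eqP : (s * (t j + t (cnext j)) - t j) ^+ 2 = 0 by lra.
  by rewrite sqrf_eq0 => /eqP ->; rewrite mulr0.
split; first by exists s0; rewrite afE s0E mulr0.
by apply/(circleP c _ r0); rewrite sqr_dist_frame_pt// expr0n addr0.
Qed.

End Construction.

(** * The region as a union of triangles *)

Section Region.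
Context {R : realType}.
Implicit Types (A B C c x : R * R) (r e : R).

(* barycentric coordinates of [x] with respect to [B] and [C] in the triangle [A B C] *)
Definition bary1 A B C x := orient A x C / orient A B C.
Definition bary2 A B C x := orient A B x / orient A B C.

(** The closed triangles with apex [c] cover the region and the open ones are disjoint; the two
    versions bound the area from above and from below. *)
Definition closed_tri A B C : set (R * R) :=
  [set x | [/\ 0 <= bary1 A B C x, 0 <= bary2 A B C x &
               bary1 A B C x + bary2 A B C x <= 1]].

Definition open_tri A B C : set (R * R) :=
  [set x | [/\ 0 < bary1 A B C x, 0 < bary2 A B C x &
               bary1 A B C x + bary2 A B C x < 1]].

Lemma bary_point A B C x : orient A B C != 0 ->
  x = (A.1 + bary1 A B C x * (B.1 - A.1) + bary2 A B C x * (C.1 - A.1),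
       A.2 + bary1 A B C x * (B.2 - A.2) + bary2 A B C x * (C.2 - A.2)).
Proof.
rewrite /bary1 /bary2 /orient => D0.
by rewrite [LHS]surjective_pairing; congr pair; field.
Qed.

Section TangentialRegion.
Variables (n : nat) (P u : 'I_n.+1 -> R * R) (c : R * R) (r e : R) (t : 'I_n.+1 -> R).
Hypotheses (n1 : (1 < n)%N) (T : tangential P c r e u t).

Let side j := t j + t (cnext j).

Let r0 : 0 < r := tan_r0 T.
Let t0 : forall j, 0 < t j := tan_t0 T.
Let uu : forall j, unitv (u j) := tan_u T.

Let side_gt0 j : 0 < side j.
Proof. by rewrite addr_gt0. Qed.

Let ee : e ^+ 2 = 1.
Proof. by case: (tan_e T) => ->; rewrite ?sqrrN expr1n. Qed.

Let e_neq0 : e != 0.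
Proof. by case: (tan_e T) => ->; rewrite ?oppr_eq0 oner_eq0. Qed.

Lemma orient_center_side j : orient c (P j) (P (cnext j)) = e * (r * side j).
Proof.
rewrite orient_rot (tan_PS T) (tan_P T) orient_frame// -mulrDr /side.
by rewrite (_ : height c (u j) c = 0) ?subr0; [ring | rewrite /height; ring].
Qed.

Let D_neq0 j : orient c (P j) (P (cnext j)) != 0.
Proof. by rewrite orient_center_side !mulf_neq0// gt_eqF. Qed.

Let hA j : height c (u j) (P j) = r.
Proof. by rewrite (tan_P T) height_frame_pt. Qed.

Let hB j : height c (u j) (P (cnext j)) = r.
Proof. by rewrite (tan_PS T) height_frame_pt. Qed.

Lemma height_le_vertex j i : height c (u j) (P i) <= r.
Proof.
have [->|ij] := eqVneq i j; first by rewrite hA.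
have [->|ij'] := eqVneq i (cnext j); first by rewrite hB.
by rewrite ltW// (tan_lt T).
Qed.

Let lam j x := bary1 c (P j) (P (cnext j)) x.
Let mu j x := bary2 c (P j) (P (cnext j)) x.

Lemma height_bary j i x : height c (u i) x =
  lam j x * height c (u i) (P j) + mu j x * height c (u i) (P (cnext j)).
Proof.
rewrite {1}(bary_point x (D_neq0 j)) -/(lam j x) -/(mu j x) /height /=; ring.
Qed.

(* The ray from [c] through a vertex bisects the two adjacent unit normals, so the
   sign of a barycentric coordinate is read off a difference of heights. *)
Lemma bary1_height j x :
  (height c (u j) x - height c (u (cnext j)) x) * (r ^+ 2 + t (cnext j) ^+ 2) =
  2 * t (cnext j) * r * side j * lam j x.
Proof.
rewrite (height_bary j) (height_bary j (cnext j)) hA hB hA.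
rewrite (_ : _ - _ = lam j x * (r - height c (u (cnext j)) (P j))); last by ring.
(* With [s] the tangent length at the shared vertex, [2 s r / (r^2 + s^2)] is the sine of the turn
   there; [key] gives the distance from [P j] to the next tangent line. [G1] and [G2] below are the
   double-angle rotation with denominators cleared. *)
suff key : (r - height c (u (cnext j)) (P j)) * (r ^+ 2 + t (cnext j) ^+ 2) =
    2 * t (cnext j) * r * side j by rewrite -mulrA key mulrC.
have := tan_PS T j; rewrite (tan_P T (cnext j)) /frame_pt => -[E1 E2].
rewrite (tan_P T j) /height /frame_pt /= -/(side j) /side.
set v := u (cnext j) in E1 E2 *; set w := u j in E1 E2 *.
set s := t (cnext j) in E1 E2 *; set q := t j.
have ww : w.1 ^+ 2 + w.2 ^+ 2 = 1 := uu j.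
have F1 : r * v.1 + e * s * v.2 = r * w.1 - e * s * w.2 by lra.
have F2 : r * v.2 - e * s * v.1 = r * w.2 + e * s * w.1 by lra.
have G1 : (r ^+ 2 + s ^+ 2) * v.1 = (r ^+ 2 - s ^+ 2) * w.1 - 2 * r * e * s * w.2.
  transitivity (r * (r * v.1 + e * s * v.2) - e * s * (r * v.2 - e * s * v.1)).
    by ring: ee.
  by rewrite F1 F2; ring: ee.
have G2 : (r ^+ 2 + s ^+ 2) * v.2 = (r ^+ 2 - s ^+ 2) * w.2 + 2 * r * e * s * w.1.
  transitivity (r * (r * v.2 - e * s * v.1) + e * s * (r * v.1 + e * s * v.2)).
    by ring: ee.
  by rewrite F1 F2; ring: ee.
transitivity ((r ^+ 2 + s ^+ 2) * r - (r * w.1 + e * q * w.2) * ((r ^+ 2 + s ^+ 2) * v.1)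
   - (r * w.2 - e * q * w.1) * ((r ^+ 2 + s ^+ 2) * v.2)); first by ring.
rewrite G1 G2.
transitivity ((r ^+ 2 + s ^+ 2) * r - (w.1 ^+ 2 + w.2 ^+ 2) *
   (r * (r ^+ 2 - s ^+ 2) - 2 * r * q * s * e ^+ 2)); first by ring.
by rewrite ww ee; ring.
Qed.

Lemma bary2_height j x :
  (height c (u (cnext j)) x - height c (u j) x) * (r ^+ 2 + t (cnext j) ^+ 2) =
  2 * t (cnext j) * r * side (cnext j) * mu (cnext j) x.
Proof.
rewrite (height_bary (cnext j)) (height_bary (cnext j) j) hA hB hB.
rewrite (_ : _ - _ = mu (cnext j) x *
  (r - height c (u j) (P (cnext (cnext j))))); last by ring.
suff key : (r - height c (u j) (P (cnext (cnext j)))) *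
    (r ^+ 2 + t (cnext j) ^+ 2) = 2 * t (cnext j) * r * side (cnext j).
  by rewrite -mulrA key mulrC.
have := tan_PS T j; rewrite (tan_P T (cnext j)) /frame_pt => -[E1 E2].
rewrite (tan_PS T (cnext j)) /height /frame_pt /= -/(side (cnext j)) /side.
set v := u (cnext j) in E1 E2 *; set w := u j in E1 E2 *.
set s := t (cnext j) in E1 E2 *; set q := t (cnext (cnext j)).
have vv : v.1 ^+ 2 + v.2 ^+ 2 = 1 := uu (cnext j).
have F1 : r * w.1 - e * s * w.2 = r * v.1 + e * s * v.2 by lra.
have F2 : r * w.2 + e * s * w.1 = r * v.2 - e * s * v.1 by lra.
have G1 : (r ^+ 2 + s ^+ 2) * w.1 = (r ^+ 2 - s ^+ 2) * v.1 + 2 * r * e * s * v.2.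
  transitivity (r * (r * w.1 - e * s * w.2) + e * s * (r * w.2 + e * s * w.1)).
    by ring: ee.
  by rewrite F1 F2; ring: ee.
have G2 : (r ^+ 2 + s ^+ 2) * w.2 = (r ^+ 2 - s ^+ 2) * v.2 - 2 * r * e * s * v.1.
  transitivity (r * (r * w.2 + e * s * w.1) - e * s * (r * w.1 - e * s * w.2)).
    by ring: ee.
  by rewrite F1 F2; ring: ee.
transitivity ((r ^+ 2 + s ^+ 2) * r - (r * v.1 - e * q * v.2) * ((r ^+ 2 + s ^+ 2) * w.1)
   - (r * v.2 + e * q * v.1) * ((r ^+ 2 + s ^+ 2) * w.2)); first by ring.
rewrite G1 G2.
transitivity ((r ^+ 2 + s ^+ 2) * r - (v.1 ^+ 2 + v.2 ^+ 2) *
   (r * (r ^+ 2 - s ^+ 2) - 2 * r * q * s * e ^+ 2)); first by ring.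
by rewrite vv ee; ring.
Qed.

(** The triangle is that of a normal for which the height of [x] is maximal: comparison with the two
    neighbouring normals gives the signs of the coordinates, and the bound [r] gives their sum. *)
Lemma halfplanes_sub_tris x : (forall j, height c (u j) x <= r) ->
  exists j, closed_tri c (P j) (P (cnext j)) x.
Proof.
move=> Hx.
case: (@arg_maxP _ _ _ ord0 xpredT (fun j => height c (u j) x) isT) => j _ jmax.
exists j; have pos i : 0 < r ^+ 2 + t i ^+ 2 by rewrite addr_gt0// exprn_gt0.
split.
- rewrite -/(lam j x) -(@pmulr_rge0 _ (2 * t (cnext j) * r * side j)).
    by rewrite -bary1_height mulr_ge0 ?(ltW (pos _))// subr_ge0; exact: jmax.
  by rewrite !mulr_gt0.
- have [i ij] := cnext_surj j; rewrite ij -/(mu (cnext i) x).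
  rewrite -(@pmulr_rge0 _ (2 * t (cnext i) * r * side (cnext i))).
    by rewrite -bary2_height mulr_ge0 ?(ltW (pos _))// subr_ge0 -ij; exact: jmax.
  by rewrite !mulr_gt0.
- by have := Hx j; rewrite (height_bary j) hA hB -mulrDl ger_pMl.
Qed.

Lemma sum_cnext (F : 'I_n.+1 -> R) : \sum_j F (cnext j) = \sum_j F j.
Proof. by rewrite [RHS](reindex_inj (@cnext_inj n)). Qed.

Lemma sum_delta (F : 'I_n.+1 -> R) j : \sum_i (i == j)%:R * F i = F j.
Proof.
rewrite (bigD1 j)//= eqxx mul1r big1 ?addr0// => i /negbTE ->.
by rewrite mul0r.
Qed.

(* The sides sum to zero, hence so do the vectors [side j * u j]: the weighted mean
   of the points of tangency is the centre. *)
Lemma center_in_region : polygon_region P c.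
Proof.
pose prev := invF (@cnext_inj n).
have prevK j : prev (cnext j) = j by exact: invF_f.
pose s := \sum_j side j; have s0 : 0 < s.
  by rewrite /s (bigD1 ord0)//= ltr_pwDl// sumr_ge0// => j _; exact: ltW.
have closing (f : R * R -> R) (g : R * R -> R) :
    (forall j, f (P (cnext j)) - f (P j) = e * side j * g (u j)) ->
    \sum_j side j * g (u j) = 0.
  move=> fg; apply: (mulfI e_neq0); rewrite mulr0 mulr_sumr.
  under eq_bigr do rewrite mulrA -fg.
  by rewrite sumrB (sum_cnext (fun j => f (P j))) subrr.
have su1 : \sum_j side j * (u j).1 = 0.
  apply: (closing snd fst) => j; rewrite (tan_PS T) (tan_P T) /= /side; ring.
have su2 : \sum_j side j * (u j).2 = 0.
  apply: oppr_inj; rewrite oppr0 -sumrN; under eq_bigr do rewrite -mulrN.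
  apply: (closing fst (fun v => - v.2)) => j.
  by rewrite (tan_PS T) (tan_P T) /= /side; ring.
(* The point of tangency on side [j] divides it with weights [t (cnext j)] and [t j]. Collecting the
   coefficient of [P i] from its two sides gives [t (cnext i) + t (prev i)]. *)
have wsum (f : R * R -> R) (cf : R) (g : R * R -> R) : \sum_j side j * g (u j) = 0 ->
    (forall j, t (cnext j) * f (P j) + t j * f (P (cnext j)) = side j * (cf + r * g (u j))) ->
    cf = \sum_i (t (cnext i) + t (prev i)) / s * f (P i).
  move=> g0 fg.
  under eq_bigr do rewrite mulrAC mulrDl.
  rewrite -mulr_suml big_split /=.
  rewrite -(sum_cnext (fun i => t (prev i) * f (P i))) -big_split /=.
  under eq_bigr do rewrite prevK fg mulrDr.
  rewrite big_split /= -mulr_suml -/s.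
  under [X in _ + X]eq_bigr do rewrite mulrCA.
  by rewrite -mulr_sumr g0 mulr0 addr0 mulrC mulKf// gt_eqF.
exists (fun i => (t (cnext i) + t (prev i)) / s); split.
- by move=> i; rewrite divr_ge0 ?(ltW s0)// addr_ge0// ltW.
- rewrite [RHS](wsum (fun=> 1) 1 (fun=> 0)).
  + by apply: eq_bigr => i _; rewrite mulr1.
  + by apply: big1 => j _; rewrite mulr0.
  + by move=> j; rewrite mulr0 addr0 !mulr1 addrC.
- rewrite [LHS]surjective_pairing; congr pair.
    apply: (wsum fst c.1 fst su1) => j.
    by rewrite (tan_PS T) (tan_P T) /= /side; ring.
  apply: (wsum snd c.2 snd su2) => j.
  by rewrite (tan_PS T) (tan_P T) /= /side; ring.
Qed.

Lemma tri_sub_region j : closed_tri c (P j) (P (cnext j)) `<=` polygon_region P.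
Proof.
move=> x [l0 m0 lm1]; have [w [w0 w1 wE]] := center_in_region.
have xE := bary_point x (D_neq0 j).
rewrite -/(lam j x) -/(mu j x) in l0 m0 lm1 xE.
exists (fun i => (1 - lam j x - mu j x) * w i + lam j x * (i == j)%:R +
           mu j x * (i == cnext j)%:R).
have wsum (f : R * R -> R) : \sum_i ((1 - lam j x - mu j x) * w i +
    lam j x * (i == j)%:R + mu j x * (i == cnext j)%:R) * f (P i) =
    (1 - lam j x - mu j x) * (\sum_i w i * f (P i)) + lam j x * f (P j) +
    mu j x * f (P (cnext j)).
  rewrite -(sum_delta (fun i => f (P i)) j) -(sum_delta (fun i => f (P i)) (cnext j)).
  by rewrite !mulr_sumr -!big_split /=; apply: eq_bigr => i _; ring.
split.
- have k0 : 0 <= 1 - lam j x - mu j x by rewrite -addrA -opprD subr_ge0.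
  by move=> i; rewrite !addr_ge0// mulr_ge0.
- have := wsum (fun=> 1); rewrite !mulr1.
  under eq_bigr do rewrite mulr1.
  under [in X in _ = X -> _]eq_bigr do rewrite mulr1.
  by rewrite w1 => ->; ring.
- rewrite !wsum {1}xE; move: (wE) => /(congr1 fst) /= <-.
  by move: (wE) => /(congr1 snd) /= <-; congr pair; ring.
Qed.

Lemma region_halfplanes :
  polygon_region P = [set x | forall j, height c (u j) x <= r].
Proof.
apply/seteqP; split=> x.
  move=> [w [w0 w1 wE]] j; rewrite (hull_height _ _ w1 wE).
  rewrite -[leRHS]mul1r -w1 mulr_suml; apply: ler_sum => i _.
  by rewrite ler_wpM2l// height_le_vertex.
by move=> /halfplanes_sub_tris[j]; exact: tri_sub_region.
Qed.

Lemma region_sub_tris :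
  polygon_region P `<=` \bigcup_j closed_tri c (P j) (P (cnext j)).
Proof.
by rewrite region_halfplanes => x /halfplanes_sub_tris[j xj]; exists j.
Qed.

Lemma open_tri_sub_region j : open_tri c (P j) (P (cnext j)) `<=` polygon_region P.
Proof.
by move=> x [l0 m0 lm1]; apply: (@tri_sub_region j); split; exact: ltW.
Qed.

(** Both ends of side [j] attain the maximal height [r] for [u j], and at least one of them is off
    side [i]. So an open triangle determines its index, which makes these triangles disjoint. *)
Lemma open_tri_height_lt i j x : i != j -> open_tri c (P j) (P (cnext j)) x ->
  height c (u i) x < height c (u j) x.
Proof.
move=> ij [l0 m0 _]; rewrite (height_bary j i x) (height_bary j j x) hA hB.
have hi := height_le_vertex i j; have hi' := height_le_vertex i (cnext j).
have [E|jE] := eqVneq j (cnext i).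
  apply: ler_ltD; first by rewrite ler_pM2l.
  rewrite ltr_pM2l// (tan_lt T)// E ?cnext2_neq// cnext_neq//; exact: ltnW.
apply: ltr_leD; last by rewrite ler_pM2l.
by rewrite ltr_pM2l// (tan_lt T)// eq_sym.
Qed.

Lemma trivIset_open_tri :
  trivIset setT (fun j => open_tri c (P j) (P (cnext j))).
Proof.
apply/trivIsetP => i j _ _ ij; apply/seteqP; split => // x [xi xj].
have := open_tri_height_lt ij xj; rewrite eq_sym in ij.
by have /ltW := open_tri_height_lt ij xi; rewrite leNgt => /negP.
Qed.

Lemma height_circle_le x v : unitv v -> circle c r x -> height c v x <= r.
Proof.
move=> vv /(circleP c _ r0) xr; rewrite /unitv in vv; rewrite /height.
set p := x.1 - c.1 in xr *; set q := x.2 - c.2 in xr *.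
have : (p * v.1 + q * v.2) ^+ 2 <= r ^+ 2.
  have : 0 <= (p * v.2 - q * v.1) ^+ 2 by exact: sqr_ge0.
  have -> : (p * v.2 - q * v.1) ^+ 2 =
     (p ^+ 2 + q ^+ 2) * (v.1 ^+ 2 + v.2 ^+ 2) - (p * v.1 + q * v.2) ^+ 2 by ring.
  by rewrite vv xr mulr1 subr_ge0.
by apply: contraTT; rewrite -!ltNge => rh; rewrite ltr_pXn2r ?nnegrE ?(ltW r0)// ltW// (lt_trans r0).
Qed.

Lemma tangential_circumscribed : circumscribed P c r.
Proof.
split => //; first by move=> x xr; rewrite region_halfplanes => j; exact: height_circle_le.
by move=> j; apply: tangential_side_tangent T.
Qed.

End TangentialRegion.
End Region.

(** * The area of a triangle *)

Section TriangleArea.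
Context {R : realType}.
Implicit Types (A B C P Q : R * R) (x y : R).
Local Notation leb := (@lebesgue_measure R).

(** As a polynomial, the line has an algebraic primitive. On a vertical side the slope is 0 by
    division by zero, and [under_side] is then supported on one point. *)
Definition line_poly P Q : {poly R} :=
  P.2%:P + ((Q.2 - P.2) / (Q.1 - P.1))%:P * ('X - P.1%:P).

Definition under_side P Q : R -> R := (fun x => (line_poly P Q).[x]) \_ `[P.1, Q.1].

Lemma line_polyE P Q x :
  (line_poly P Q).[x] = P.2 + (Q.2 - P.2) / (Q.1 - P.1) * (x - P.1).
Proof. by rewrite /line_poly !hornerE. Qed.

Lemma line_polyC P Q x : P.1 != Q.1 -> (line_poly P Q).[x] = (line_poly Q P).[x].
Proof.
move=> pq; have qp : Q.1 != P.1 by rewrite eq_sym.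
by rewrite !line_polyE; field; rewrite !subr_eq0 pq qp.
Qed.

Lemma integrable_under_side P Q : leb.-integrable setT (EFin \o under_side P Q).
Proof.
rewrite /under_side -restrict_EFin; apply: (iffLR (integrable_mkcond _ _)) => //.
apply: continuous_compact_integrable; first exact: segment_compact.
by apply: continuous_subspaceT => x; exact: continuous_horner.
Qed.

Lemma integral_under_side P Q : P.1 < Q.1 ->
  (\int[leb]_x (under_side P Q x)%:E = ((Q.1 - P.1) * (P.2 + Q.2) / 2)%:E)%E.
Proof.
move=> pq; pose k := (Q.2 - P.2) / (Q.1 - P.1).
pose F : {poly R} := P.2%:P * 'X + (k / 2)%:P * ('X - P.1%:P) ^+ 2.
have dF : F^`() = line_poly P Q.
  have kE : k%:P = (k / 2)%:P + (k / 2)%:P by rewrite -polyCD -splitr.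
  rewrite /F /line_poly -/k kE expr2 derivD !derivM derivXsubC !derivC derivX.
  by ring.
transitivity (\int[leb]_(x in `[P.1, Q.1]) ((line_poly P Q).[x])%:E)%E.
  rewrite [RHS]integral_mkcond; apply: eq_integral => x _.
  by rewrite -[LHS]/((EFin \o under_side P Q) x) /under_side -restrict_EFin.
rewrite (@continuous_FTC2 _ _ (fun x => F.[x]))//.
- rewrite -EFinB /F !hornerE /= /k; congr (_%:E); field.
  by rewrite subr_eq0 gt_eqF.
- by apply: continuous_subspaceT => x; exact: continuous_horner.
- split=> [x _| |]; first exact: derivable_horner.
    by apply: cvg_at_right_filter; exact: continuous_horner.
  by apply: cvg_at_left_filter; exact: continuous_horner.
- by move=> x _; rewrite -derivE dF.
Qed.

Lemma integral_under_side0 P Q : Q.1 <= P.1 ->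
  (\int[leb]_x (under_side P Q x)%:E = 0)%E.
Proof.
move=> qp.
transitivity (\int[leb]_(x in `[P.1, Q.1]) ((line_poly P Q).[x])%:E)%E.
  rewrite [RHS]integral_mkcond; apply: eq_integral => x _.
  by rewrite -[LHS]/((EFin \o under_side P Q) x) /under_side -restrict_EFin.
move: qp; rewrite le_eqVlt => /predU1P[<-|qp].
  by rewrite set_itv1 integral_set1.
by rewrite set_itv_ge ?integral_set0// bnd_simp -ltNge.
Qed.

(* the trapezoid under the side [P Q], counted positively when [Q] is on the left of [P] *)
Definition signed_side P Q x := under_side Q P x - under_side P Q x.

Lemma integrable_signed_side P Q : leb.-integrable setT (EFin \o signed_side P Q).
Proof.
exact: (integrableB measurableT (integrable_under_side Q P) (integrable_under_side P Q)).
Qed.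

Lemma integral_signed_side P Q :
  (\int[leb]_x (signed_side P Q x)%:E = ((P.1 - Q.1) * (P.2 + Q.2) / 2)%:E)%E.
Proof.
have -> : (\int[leb]_x (signed_side P Q x)%:E =
    \int[leb]_x (under_side Q P x)%:E - \int[leb]_x (under_side P Q x)%:E)%E.
  exact: (integralB measurableT (integrable_under_side Q P) (integrable_under_side P Q)).
have [pq|qp|pq] := ltgtP P.1 Q.1.
- rewrite integral_under_side0 ?ltW// integral_under_side// -EFinB; congr (_%:E); ring.
- rewrite integral_under_side// integral_under_side0 ?ltW// -EFinB; congr (_%:E); ring.
- rewrite !integral_under_side0 ?pq// -EFinB; congr (_%:E); ring.
Qed.

Lemma signed_side_right P Q x : x < P.1 -> x < Q.1 -> signed_side P Q x = 0.
Proof.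
move=> xp xq; rewrite /signed_side /under_side !patchE !memNset ?subrr//=;
  by rewrite in_itv/=; lra.
Qed.

Lemma signed_side_left P Q x : P.1 < x -> Q.1 < x -> signed_side P Q x = 0.
Proof.
move=> xp xq; rewrite /signed_side /under_side !patchE !memNset ?subrr//=;
  by rewrite in_itv/=; lra.
Qed.

Lemma signed_side_lt P Q x : P.1 < x -> x < Q.1 ->
  signed_side P Q x = - (line_poly P Q).[x].
Proof.
move=> xp xq; rewrite /signed_side /under_side !patchE memNset ?mem_set ?sub0r//=;
  by rewrite in_itv/=; lra.
Qed.

Lemma signed_side_gt P Q x : Q.1 < x -> x < P.1 ->
  signed_side P Q x = (line_poly P Q).[x].
Proof.
move=> xp xq; rewrite line_polyC ?gt_eqF ?(lt_trans xp)//.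
rewrite /signed_side /under_side !patchE mem_set ?memNset ?subr0//=;
  by rewrite in_itv/=; lra.
Qed.

Lemma orient_line P Q x y : P.1 != Q.1 ->
  orient P Q (x, y) = (Q.1 - P.1) * (y - (line_poly P Q).[x]).
Proof.
by move=> pq; rewrite line_polyE /orient /=; field; rewrite subr_eq0 eq_sym.
Qed.

(* [S] is the triangle [A B C] up to its boundary *)
Definition tri_between A B C (S : set (R * R)) :=
  (forall z, 0 < orient A B z -> 0 < orient B C z -> 0 < orient C A z -> S z) /\
  (forall z, S z -> [/\ 0 <= orient A B z, 0 <= orient B C z & 0 <= orient C A z]).

Lemma tri_between_rot A B C S : tri_between A B C S -> tri_between B C A S.
Proof.
move=> [SI SC]; split=> z; first by move=> ? ? ?; exact: SI.
by move=> /SC[].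
Qed.

Lemma orient_cramer A B C z :
  orient B C z * (A.1 - z.1) + orient C A z * (B.1 - z.1) + orient A B z * (C.1 - z.1)
  = 0.
Proof. by rewrite /orient; ring. Qed.

Lemma orient_sum A B C z :
  orient B C z + orient C A z + orient A B z = orient A B C.
Proof. by rewrite /orient; ring. Qed.

Lemma lebesgue_between a b (S : set R) : a <= b -> measurable S ->
  (forall y, a < y < b -> S y) -> (forall y, S y -> a <= y <= b) ->
  leb S = (b - a)%:E.
Proof.
move=> ab mS oS Sc; apply/eqP; rewrite eq_le; apply/andP; split.
  have <- : leb `[a, b]%classic = (b - a)%:E.
    rewrite lebesgue_measure_itv/= lte_fin lt_neqAle ab andbT.
    by case: eqVneq => [->|_]; rewrite ?subrr// -EFinB.
  by apply: le_measure; rewrite ?inE//; move=> y /Sc; rewrite /= in_itv.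
have <- : leb `]a, b[%classic = (b - a)%:E.
  rewrite lebesgue_measure_itv/= lte_fin lt_neqAle ab andbT.
  by case: eqVneq => [->|_]; rewrite ?subrr// -EFinB.
by apply: le_measure; rewrite ?inE//; move=> y; rewrite /= in_itv/= => /oS.
Qed.

(** The relation [p a = q b] gives [p] and [q] the same sign, and their sum is positive. *)
Lemma gt0_of_ratio (D p q a b : R) : 0 < D -> 0 < a * b -> p + q = D -> p * a = q * b ->
  0 < q.
Proof.
move=> D0 ab pqD; have -> : p = D - q by rewrite -pqD addrK.
move=> E; have Eab : q * (a + b) = D * a by rewrite mulrDr -E; ring.
have H : q * (a * (a + b)) = D * a ^+ 2 by rewrite mulrCA Eab; ring.
have a0 : a != 0 by apply: contraTneq ab => ->; rewrite mul0r ltxx.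
have a2 : 0 < a ^+ 2 by rewrite lt_def sqrf_eq0 a0 sqr_ge0.
have c0 : 0 < a * (a + b) by rewrite mulrDr -expr2 addr_gt0.
by rewrite -(pmulr_lgt0 _ c0) H mulr_gt0.
Qed.

Lemma weighted_sum_gt0 (o1 o2 o3 d1 d2 d3 : R) :
  0 <= o1 -> 0 <= o2 -> 0 <= o3 -> 0 < o1 + o2 + o3 ->
  0 < d1 -> 0 < d2 -> 0 < d3 -> 0 < o1 * d1 + o2 * d2 + o3 * d3.
Proof.
move=> p1 p2 p3 s0 d10 d20 d30.
have q1 : 0 <= o1 * d1 by rewrite mulr_ge0// ltW.
have q2 : 0 <= o2 * d2 by rewrite mulr_ge0// ltW.
have q3 : 0 <= o3 * d3 by rewrite mulr_ge0// ltW.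
rewrite lt_def !addr_ge0// andbT !paddr_eq0 ?addr_ge0// !mulf_eq0.
rewrite (gt_eqF d10) (gt_eqF d20) (gt_eqF d30) !orbF; apply: contraTN s0.
by move=> /andP[/andP[/eqP -> /eqP ->] /eqP ->]; rewrite !addr0 ltxx.
Qed.

Section TriangleSections.
Variables (A B C : R * R) (S : set (R * R)).
Hypotheses (D0 : 0 < orient A B C) (SE : tri_between A B C S) (mS : measurable S).

Let mSx x : measurable (xsection S x).
Proof. exact: measurable_xsection. Qed.

(** The vertical line crosses only the sides at [A]; by the counterclockwise order, [A B] bounds the
    section from below and [C A] from above. *)
Lemma section_one_left x : A.1 < x -> x < B.1 -> x < C.1 ->
  leb (xsection S x) =
  (signed_side A B x + signed_side B C x + signed_side C A x)%:E.
Proof.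
move=> xA xB xC; case: SE => SI SC.
rewrite signed_side_lt// signed_side_right// signed_side_gt// addr0 addrC.
have AB : A.1 != B.1 by rewrite lt_eqF// (lt_trans xA).
have CA : C.1 != A.1 by rewrite gt_eqF// (lt_trans xA).
apply: lebesgue_between => [|//|y /andP[y1 y2]|y /xsectionP/SC[ o1 o2 o3]].
- have E0 : orient A B (x, (line_poly A B).[x]) = 0.
    by rewrite orient_line// subrr mulr0.
  have := orient_cramer A B C (x, (line_poly A B).[x]).
  have := orient_sum A B C (x, (line_poly A B).[x]).
  rewrite E0 mul0r !addr0 /= => E1 E2.
  have : 0 < orient C A (x, (line_poly A B).[x]).
    apply: (gt0_of_ratio (a := x - A.1) (b := B.1 - x) D0 _ E1); last by lra.
    by rewrite mulr_gt0// subr_gt0.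
  by rewrite (orient_line _ _ CA); set l := _.[x]; set l' := _.[x]; nra.
- have o1 : 0 < orient A B (x, y) by rewrite orient_line//; nra.
  have o2 : 0 < orient C A (x, y) by rewrite orient_line//; nra.
  apply/xsectionP/SI => //.
  by have := orient_cramer A B C (x, y); rewrite /=; nra.
- rewrite orient_line// in o1; rewrite orient_line// in o3.
  by apply/andP; split; nra.
Qed.

Lemma section_one_right x : x < A.1 -> B.1 < x -> C.1 < x ->
  leb (xsection S x) =
  (signed_side A B x + signed_side B C x + signed_side C A x)%:E.
Proof.
move=> xA xB xC; case: SE => SI SC.
rewrite signed_side_gt// signed_side_left// signed_side_lt// addr0.
have AB : A.1 != B.1 by rewrite gt_eqF// (lt_trans xB).
have CA : C.1 != A.1 by rewrite lt_eqF// (lt_trans xC).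
apply: lebesgue_between => [|//|y /andP[y1 y2]|y /xsectionP/SC[ o1 o2 o3]].
- have E0 : orient A B (x, (line_poly A B).[x]) = 0.
    by rewrite orient_line// subrr mulr0.
  have := orient_cramer A B C (x, (line_poly A B).[x]).
  have := orient_sum A B C (x, (line_poly A B).[x]).
  rewrite E0 mul0r !addr0 /= => E1 E2.
  have : 0 < orient C A (x, (line_poly A B).[x]).
    apply: (gt0_of_ratio (a := x - A.1) (b := B.1 - x) D0 _ E1); last by lra.
    by rewrite nmulr_rgt0 subr_lt0.
  by rewrite (orient_line _ _ CA); set l := _.[x]; set l' := _.[x]; nra.
- have o1 : 0 < orient A B (x, y) by rewrite orient_line//; nra.
  have o2 : 0 < orient C A (x, y) by rewrite orient_line//; nra.
  apply/xsectionP/SI => //.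
  by have := orient_cramer A B C (x, y); rewrite /=; nra.
- rewrite orient_line// in o1; rewrite orient_line// in o3.
  by apply/andP; split; nra.
Qed.

Lemma section_all_left x : A.1 < x -> B.1 < x -> C.1 < x -> xsection S x = set0.
Proof.
move=> xA xB xC; apply/seteqP; split => // y /xsectionP/SE.2[q3 q1 q2].
have S0 := orient_sum A B C (x, y); have E := orient_cramer A B C (x, y).
have := @weighted_sum_gt0 _ _ _ (x - A.1) (x - B.1) (x - C.1) q1 q2 q3.
rewrite -subr_gt0 in xA; rewrite -subr_gt0 in xB; rewrite -subr_gt0 in xC.
by rewrite S0 => /(_ D0 xA xB xC); move: E => /=; lra.
Qed.

Lemma section_all_right x : x < A.1 -> x < B.1 -> x < C.1 -> xsection S x = set0.
Proof.
move=> xA xB xC; apply/seteqP; split => // y /xsectionP/SE.2[q3 q1 q2].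
have S0 := orient_sum A B C (x, y); have E := orient_cramer A B C (x, y).
have := @weighted_sum_gt0 _ _ _ (A.1 - x) (B.1 - x) (C.1 - x) q1 q2 q3.
rewrite -subr_gt0 in xA; rewrite -subr_gt0 in xB; rewrite -subr_gt0 in xC.
by rewrite S0 => /(_ D0 xA xB xC); move: E => /=; lra.
Qed.

End TriangleSections.

(** There are eight positions of the vertices relative to the vertical line; cyclic rotation reduces
    them to none or exactly one vertex on a given side. *)
Lemma section_tri A B C S x : 0 < orient A B C -> tri_between A B C S -> measurable S ->
  x != A.1 -> x != B.1 -> x != C.1 ->
  leb (xsection S x) =
  (signed_side A B x + signed_side B C x + signed_side C A x)%:E.
Proof.
move=> D0 SE mS.
have D1 : 0 < orient B C A by rewrite -orient_rot.
have D2 : 0 < orient C A B by rewrite -orient_rot.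
have SE1 := tri_between_rot SE; have SE2 := tri_between_rot SE1.
have rot1 : signed_side A B x + signed_side B C x + signed_side C A x =
  signed_side B C x + signed_side C A x + signed_side A B x by ring.
have rot2 : signed_side A B x + signed_side B C x + signed_side C A x =
  signed_side C A x + signed_side A B x + signed_side B C x by ring.
case: ltgtP => // xA _; case: ltgtP => // xB _; case: ltgtP => // xC _.
- by rewrite (section_all_right D0 SE)// measure0 !signed_side_right// !addr0.
- by rewrite rot2; exact: (section_one_left D2 SE2).
- by rewrite rot1; exact: (section_one_left D1 SE1).
- exact: (section_one_right D0 SE).
- exact: (section_one_left D0 SE).
- by rewrite rot1; exact: (section_one_right D1 SE1).
- by rewrite rot2; exact: (section_one_right D2 SE2).
- by rewrite (section_all_left D0 SE)// measure0 !signed_side_left// !addr0.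
Qed.

(** Integrating the vertical sections, known off the three vertex abscissas, yields the shoelace
    formula. *)
Lemma area_tri_between A B C S : 0 < orient A B C -> tri_between A B C S ->
  measurable S -> (leb \x leb)%E S = (orient A B C / 2)%:E.
Proof.
move=> D0 SE mS.
pose f P Q x := (signed_side P Q x)%:E.
have fi P Q : leb.-integrable setT (f P Q) by exact: integrable_signed_side.
have fi2 : leb.-integrable setT (fun x => f A B x + f B C x)%E.
  exact: integrableD.
have fi3 : leb.-integrable setT (fun x => f A B x + f B C x + f C A x)%E.
  exact: integrableD.
transitivity (\int[leb]_x (f A B x + f B C x + f C A x))%E.
  apply: ae_eq_integral => //; first exact: measurable_fun_xsection.
    exact: measurable_int fi3.
  exists [set A.1; B.1; C.1]; split.
  - by apply: measurableU; [apply: measurableU|]; exact: measurable_set1.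
  - by apply: countable_lebesgue_measure0; apply: finite_set_countable.
  - move=> x /= xN; apply: contrapT => /not_orP[/not_orP[xA xB] xC].
    apply: xN => _; rewrite (section_tri D0 SE)//; exact/eqP.
rewrite (integralD measurableT fi2 (fi C A)) (integralD measurableT (fi A B) (fi B C)).
rewrite /f !integral_signed_side -!EFinD; congr (_%:E).
by rewrite /orient; field.
Qed.

Lemma measurable_fun_orient A B : measurable_fun setT (fun x : R * R => orient A B x).
Proof.
rewrite /orient; apply: measurable_funB; apply: measurable_funM => //;
  by apply: measurable_funB => //.
Qed.

Lemma tri_between_closed A B C : 0 < orient A B C ->
  tri_between A B C (closed_tri A B C).
Proof.
move=> D0.
have b1 z : bary1 A B C z * orient A B C = orient C A z.
  by rewrite divfK ?gt_eqF// -orient_rot.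
have b2 z : bary2 A B C z * orient A B C = orient A B z by rewrite divfK ?gt_eqF.
split=> z; rewrite /closed_tri /=.
  move=> oz1 oz2 oz3; move: D0 oz1 oz2 oz3 (b1 z) (b2 z) (orient_sum A B C z).
  set D := orient A B C; set o1 := orient B C z; set o2 := orient C A z.
  set o3 := orient A B z; set l := bary1 _ _ _ _; set m := bary2 _ _ _ _ => *.
  by split; nra.
move=> []; move: D0 (b1 z) (b2 z) (orient_sum A B C z).
set D := orient A B C; set o1 := orient B C z; set o2 := orient C A z.
set o3 := orient A B z; set l := bary1 _ _ _ _; set m := bary2 _ _ _ _ => *.
by split; nra.
Qed.

Lemma tri_between_open A B C : 0 < orient A B C ->
  tri_between A B C (open_tri A B C).
Proof.
move=> D0.
have b1 z : bary1 A B C z * orient A B C = orient C A z.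
  by rewrite divfK ?gt_eqF// -orient_rot.
have b2 z : bary2 A B C z * orient A B C = orient A B z by rewrite divfK ?gt_eqF.
split=> z; rewrite /open_tri /=.
  move=> oz1 oz2 oz3; move: D0 oz1 oz2 oz3 (b1 z) (b2 z) (orient_sum A B C z).
  set D := orient A B C; set o1 := orient B C z; set o2 := orient C A z.
  set o3 := orient A B z; set l := bary1 _ _ _ _; set m := bary2 _ _ _ _ => *.
  by split; nra.
move=> []; move: D0 (b1 z) (b2 z) (orient_sum A B C z).
set D := orient A B C; set o1 := orient B C z; set o2 := orient C A z.
set o3 := orient A B z; set l := bary1 _ _ _ _; set m := bary2 _ _ _ _ => *.
by split; nra.
Qed.

Lemma orient_swap A B (x : R * R) : orient A x B = - orient A B x.
Proof. by rewrite /orient; ring. Qed.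

Lemma bary_swap A B C (x : R * R) : bary1 A C B x = bary2 A B C x.
Proof. by rewrite /bary1 /bary2 orient_swap [orient A C B]orient_swap invrN mulrNN. Qed.

Lemma closed_tri_swap A B C : closed_tri A C B = closed_tri A B C.
Proof.
rewrite /closed_tri; apply/seteqP; split=> x /= [];
  by rewrite (bary_swap A B C) -(bary_swap A C B) addrC => *; split.
Qed.

Lemma open_tri_swap A B C : open_tri A C B = open_tri A B C.
Proof.
rewrite /open_tri; apply/seteqP; split=> x /= [];
  by rewrite (bary_swap A B C) -(bary_swap A C B) addrC => *; split.
Qed.

Lemma measurable_fun_bary1 A B C : measurable_fun setT (bary1 A B C).
Proof.
rewrite /bary1; apply: measurable_funM => //.
rewrite (_ : (fun z => _) = (fun z => orient C A z)); first exact: measurable_fun_orient.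
by apply/funext => z; rewrite -orient_rot.
Qed.

Lemma measurable_fun_bary2 A B C : measurable_fun setT (bary2 A B C).
Proof. by apply: measurable_funM => //; exact: measurable_fun_orient. Qed.

Lemma measurable_closed_tri A B C : measurable (closed_tri A B C).
Proof.
have m1 := measurable_fun_bary1 A B C; have m2 := measurable_fun_bary2 A B C.
have -> : closed_tri A B C = (setT `&` bary1 A B C @^-1` `[0, +oo[) `&`
   ((setT `&` bary2 A B C @^-1` `[0, +oo[) `&`
    (setT `&` (bary1 A B C \+ bary2 A B C) @^-1` `]-oo, 1])).
  rewrite !setTI; apply/seteqP; split=> x /=; rewrite !in_itv/= ?andbT.
    by move=> [].
  by move=> [? []].
apply: measurableI; first exact: m1.
by apply: measurableI; [exact: m2 | apply: measurable_funD].
Qed.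

Lemma measurable_open_tri A B C : measurable (open_tri A B C).
Proof.
have m1 := measurable_fun_bary1 A B C; have m2 := measurable_fun_bary2 A B C.
have -> : open_tri A B C = (setT `&` bary1 A B C @^-1` `]0, +oo[) `&`
   ((setT `&` bary2 A B C @^-1` `]0, +oo[) `&`
    (setT `&` (bary1 A B C \+ bary2 A B C) @^-1` `]-oo, 1[)).
  rewrite !setTI; apply/seteqP; split=> x /=; rewrite !in_itv/= ?andbT.
    by move=> [].
  by move=> [? []].
apply: measurableI; first exact: m1.
by apply: measurableI; [exact: m2 | apply: measurable_funD].
Qed.

Lemma area_closed_tri A B C : orient A B C != 0 ->
  (leb \x leb)%E (closed_tri A B C) = (`|orient A B C| / 2)%:E.
Proof.
case: ltgtP => // D0 _.
  rewrite -closed_tri_swap -normrN -orient_swap; rewrite -oppr_gt0 -orient_swap in D0.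
  rewrite (area_tri_between D0 (tri_between_closed D0)) ?gtr0_norm//.
  exact: measurable_closed_tri.
rewrite (area_tri_between D0 (tri_between_closed D0)) ?gtr0_norm//.
exact: measurable_closed_tri.
Qed.

Lemma area_open_tri A B C : orient A B C != 0 ->
  (leb \x leb)%E (open_tri A B C) = (`|orient A B C| / 2)%:E.
Proof.
case: ltgtP => // D0 _.
  rewrite -open_tri_swap -normrN -orient_swap; rewrite -oppr_gt0 -orient_swap in D0.
  rewrite (area_tri_between D0 (tri_between_open D0)) ?gtr0_norm//.
  exact: measurable_open_tri.
rewrite (area_tri_between D0 (tri_between_open D0)) ?gtr0_norm//.
exact: measurable_open_tri.
Qed.

End TriangleArea.

(** * Area of a tangential polygon, and conclusion *)

Lemma area_tangential (R : realType) n (P u : 'I_n.+1 -> R * R) c r e (t : 'I_n.+1 -> R) :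
  (1 < n)%N -> tangential P c r e u t ->
  area P = ((\sum_j (t j + t (cnext j))) / 2 * r)%:E.
Proof.
move=> n1 T; pose tri j := closed_tri c (P j) (P (cnext j)).
pose otri j := open_tri c (P j) (P (cnext j)).
have r0 := tan_r0 T.
have s0 j : 0 < t j + t (cnext j) by rewrite addr_gt0// (tan_t0 T).
have orE j : `|orient c (P j) (P (cnext j))| = r * (t j + t (cnext j)).
  rewrite (orient_center_side T) normrM (gtr0_norm (mulr_gt0 r0 (s0 j))).
  by case: (tan_e T) => ->; rewrite ?normrN1 ?normr1 mul1r.
have D0 j : orient c (P j) (P (cnext j)) != 0.
  by rewrite -normr_gt0 orE mulr_gt0.
have sumE : (\sum_(j < n.+1) (r * (t j + t (cnext j)) / 2)%:E)%E =
   ((\sum_j (t j + t (cnext j))) / 2 * r)%:E.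
  rewrite sumEFin; congr (_%:E); rewrite mulrAC !mulr_suml.
  by apply: eq_bigr => j _; ring.
have mP : measurable (polygon_region P).
  have -> : polygon_region P = \bigcup_j tri j.
    apply/seteqP; split; first exact: region_sub_tris T.
    by move=> x [j _]; exact: (tri_sub_region T).
  by apply: fin_bigcup_measurable => // j _; exact: measurable_closed_tri.
(* Subadditivity over the closed triangles gives one inequality and additivity over the disjoint
   open ones the other, so overlaps on the boundaries need no study. *)
rewrite /area -sumE; apply/eqP; rewrite eq_le; apply/andP; split.
- pose F k := tri (inZp k).
  have mF k : measurable (F k) by exact: measurable_closed_tri.
  have sub : polygon_region P `<=` \big[setU/set0]_(k < n.+1) F k.
    move=> x /(region_sub_tris T)[j _ xj]; rewrite -bigcup_mkord.
    by exists j => //=; rewrite /F valZpK.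
  have mF' k : `I_n.+1 k -> measurable (F k) by [].
  apply: (le_trans (content_subadditive
    ((@lebesgue_measure R) \x (@lebesgue_measure R))%E mF' mP sub)).
  rewrite le_eqVlt; apply/orP; left; apply/eqP; apply: eq_bigr => j _.
  by rewrite /F valZpK -orE [LHS]area_closed_tri.
- rewrite (_ : (\sum_(j < n.+1) _)%E =
    ((@lebesgue_measure R) \x (@lebesgue_measure R))%E (\bigcup_j otri j)).
    apply: le_measure; rewrite ?inE//.
      by apply: fin_bigcup_measurable => // j _; exact: measurable_open_tri.
    by move=> x [j _]; exact: (open_tri_sub_region T).
  rewrite measure_fin_bigcup//; first last.
  + by move=> j _; exact: measurable_open_tri.
  + exact: (trivIset_open_tri n1 T).
  + exact: finite_finset.
  rewrite (fsbigE (T := 'I_n.+1) (index_enum 'I_n.+1)) ?index_enum_uniq//; last first.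
    by move=> j _; rewrite mem_index_enum.
  apply: eq_big => [j|j _]; first by rewrite in_setT.
  by rewrite -orE [RHS]area_open_tri.
Qed.

Theorem mainTheorem1 (R : realType) (k : nat) (hk : (0 < k)%N)
    (a : 'I_(2 * k).+1 -> R) (ha : forall j, 0 < a j) :
  ((exists (P : 'I_(2 * k).+1 -> R * R) (c : R * R) (r : R),
      [/\ convex_polygon P, circumscribed P c r & has_side_lengths P a])
   <-> (forall j, 0 < tlen a j))
  /\
  ((forall j, 0 < tlen a j) ->
   let s := (\sum_j a j) / 2 in
   let p := radius_poly (tlen a) in
   (exists rs : seq R,
      [/\ size rs = k, uniq rs, (forall x, x \in rs -> 0 < x) &
          forall z : R[i], root (map_poly (real_complex R) p) z <->
                           exists2 x, x \in rs & z = real_complex R x])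
   /\
   (exists r1 : R,
      [/\ 0 < r1, root p (r1 ^+ 2), (forall x, root p x -> x <= r1 ^+ 2) &
          forall (P : 'I_(2 * k).+1 -> R * R) (c : R * R) (r : R),
            convex_polygon P -> circumscribed P c r -> has_side_lengths P a ->
            r = r1 /\ area P = (s * r1)%:E])).
Proof.
have n1 : (1 < 2 * k)%N by lia.
split; first split.
- move=> [P [c [r [cvx circ sl]]]].
  have [e [u [t [T aE]]]] := circumscribed_tangential n1 ha cvx circ sl.
  by move=> j; rewrite (tlen_tangent_lengths aE) (tan_t0 T).
(* The case [m = 1] is the single turn: the polygon is built with radius [y^-1]. *)
- move=> t0; have [|y y0 Fy] := half_angle_sum_surj (m := 1) t0; first by rewrite hk.
  have r0 : 0 < y^-1 by rewrite invr_gt0.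
  have [|P [u T]] := tangential_exists t0 r0; first by rewrite invrK Fy mul1r.
  exists P, (0, 0), y^-1; split.
  + exact: tangential_convex T.
  + exact: tangential_circumscribed T.
  + by have := tangential_side_lengths T; under eq_fun do rewrite tlen_add_cnext.
move=> t0 s p; split; first exact: radius_poly_complex_roots.
have [|y y0] := half_angle_sum_surj (m := 1) t0; first by rewrite hk.
rewrite mul1r => Fy; exists y^-1; split; first by rewrite invr_gt0.
- by rewrite root_radius_poly// Fy sinpi.
- by move=> x; exact: root_radius_poly_le.
move=> P c r cvx circ sl.
have [e [u [t [T aE]]]] := circumscribed_tangential n1 ha cvx circ sl.
have tE : tlen a = t by apply/funext/tlen_tangent_lengths.
(* Both reciprocals give the angle sum [pi], and the sum is strictly increasing. *)
have rE : r = y^-1.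
  apply: invr_inj; rewrite invrK.
  have Fr := tangential_half_angle_sum T; rewrite -tE in Fr.
  by case: (ltgtP r^-1 y) => // /(half_angle_sum_lt t0); rewrite Fr Fy ltxx.
split => //; rewrite (area_tangential n1 T) -rE /s.
by congr ((_ / 2 * r)%:E); apply: eq_bigr => j _; rewrite aE.
Qed.
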